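(* Let $P\subset\mathbb{R}^d$ be a $d$-dimensional convex lattice polytope. If $P=-P$, then $$\mathrm{F}(P)\ \ge\ \mathrm{F}(C_d^\star)=\frac{2^d}{d!}\,d^{3/2};$$ otherwise, $$\mathrm{F}(P)\ \ge\ \mathrm{F}(T_d)=\frac{d+\sqrt d}{(d-1)!}.$$
   Context: A $d$-dimensional convex lattice polytope is a convex polytope $P\subset\mathbb{R}^d$ with $\dim P=d$, all of whose vertices lie in $\mathbb{Z}^d$. $\mathrm{F}(P)$ denotes the surface area of $P$, i.e. the sum of the $(d-1)$-dimensional volumes of its facets. With $e_1,\dots,e_d$ the standard unit vectors, $C_d^\star=\mathrm{conv}\{\pm e_i:1\le i\le d\}$ is the regular cross-polytope and $T_d=\mathrm{conv}\{0,e_1,\dots,e_d\}$ is the standard simplex. *)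

(* Defs.v *)
From HB Require Import structures.
From mathcomp Require Import all_boot all_order all_algebra.
From mathcomp Require Import all_classical all_reals all_analysis.

Set Implicit Arguments.
Unset Strict Implicit.
Unset Printing Implicit Defensive.

Import Order.TTheory GRing.Theory Num.Theory.
Local Open Scope classical_set_scope.
Local Open Scope ring_scope.

Section Polytopes.
Context {R : realType} {d : nat}.
Implicit Types (A P F : set 'rV[R]_d) (x v a : 'rV[R]_d).

Definition dot x a : R := \sum_(i < d) x 0 i * a 0 i.

Definition conv_hull A : set 'rV[R]_d :=
  [set x | exists n (v : 'I_n -> 'rV[R]_d) (w : 'I_n -> R),
    [/\ forall i, A (v i), forall i, 0 <= w i,
        \sum_(i < n) w i = 1 & x = \sum_(i < n) w i *: v i]].

Definition aff_hull A : set 'rV[R]_d :=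
  [set x | exists n (v : 'I_n -> 'rV[R]_d) (w : 'I_n -> R),
    [/\ forall i, A (v i), \sum_(i < n) w i = 1
      & x = \sum_(i < n) w i *: v i]].

(* The empty set has no dimension in this sense. *)
Definition has_dim A (k : nat) : Prop :=
  exists (x0 : 'rV[R]_d) (V : {vspace 'rV[R]_d}),
    aff_hull A = [set x | x - x0 \in V] /\ \dim V = k.

Definition polytope P : Prop :=
  exists2 A, finite_set A & P = conv_hull A.

(* F may be empty, or all of P (with a = 0 and b = 0). *)
Definition face P F : Prop :=
  exists a (b : R), (forall x, P x -> dot x a <= b) /\
    F = P `&` [set x | dot x a = b].

Definition vertex P v : Prop := face P [set v].

Definition facets P : set (set 'rV[R]_d) :=
  [set F | face P F /\ has_dim F d.-1].

Definition lattice_polytope P : Prop :=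
  polytope P /\ forall v, vertex P v -> forall i, v 0 i \is a Num.int.

End Polytopes.

(* Lebesgue measure on R^n as the n-fold product of the one-dimensional
   Lebesgue measure, with the product measure [\x] written out (the library
   has no measurable structure on row vectors). It is only used on compact
   sets, where all the integrands are measurable. For n = 0 it is the unit
   mass at the only point of R^0. *)
Fixpoint lebesgue_rV {R : realType} (n : nat) : set 'rV[R]_n -> \bar R :=
  match n with
  | 0 => fun A => (\1_A 0)%:E
  | m.+1 => fun A : set 'rV[R]_(1 + m) =>
      (\int[@lebesgue_measure R]_t
         lebesgue_rV [set y : 'rV[R]_m | A (row_mx t%:M y)])%E
  end.

(* k-dimensional volume of a set S contained in a k-dimensional affine subspace
   of R^d: the Lebesgue measure of S read through an isometric parametrization
   y |-> x0 + y U of that subspace (the rows of U are orthonormal). All such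
   parametrizations give the same value, by invariance of Lebesgue measure
   under isometries of R^k. *)
Definition flat_vol {R : realType} {d : nat} (k : nat) (S : set 'rV[R]_d) :
    \bar R :=
  get [set v | exists (x0 : 'rV[R]_d) (U : 'M[R]_(k, d)),
    [/\ U *m U^T = 1%:M,
        S `<=` range (fun y : 'rV[R]_k => x0 + y *m U)
      & v = lebesgue_rV [set y : 'rV[R]_k | S (x0 + y *m U)]]].

Definition surface_area {R : realType} {d : nat} (P : set 'rV[R]_d) : \bar R :=
  (\esum_(F in facets P) flat_vol d.-1 F)%E.

Definition cross_polytope (R : realType) (d : nat) : set 'rV[R]_d :=
  conv_hull [set x | exists i : 'I_d, x = delta_mx 0 i \/ x = - delta_mx 0 i].

Definition std_simplex (R : realType) (d : nat) : set 'rV[R]_d :=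
  conv_hull (0 |` [set x | exists i : 'I_d, x = delta_mx 0 i]).

Arguments cross_polytope : clear implicits.
Arguments std_simplex : clear implicits.

(* Main.v *)
Require Import Defs.
From HB Require Import structures.
From mathcomp Require Import all_boot all_order all_algebra.
From mathcomp Require Import all_classical all_reals all_analysis.
From mathcomp Require Import measurable_realfun ring lra.

Set Implicit Arguments.
Unset Strict Implicit.
Unset Printing Implicit Defensive.

Import Order.TTheory GRing.Theory Num.Theory.
Import numFieldNormedType.Exports.
Local Open Scope classical_set_scope.
Local Open Scope ring_scope.

(** The proof bounds the surface area through the outer unit normals [u_F] of
    the facets [F] of [P].

    For every lattice polytope, each facet contains a [(d-1)]-simplex spanned by
    [d] lattice points. If [D_F] is [(d-1)!] times the volume of that simplex,
    then [A_F = D_F u_F] is an integer vector: for a lattice point [p] one step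
    [e_i] away from a vertex of the simplex, [D_F |(u_F)_i|] is the absolute
    value of the determinant spanned by the edges from [p] to the vertices
    ([facet_det], [flat_vol_int]). An integer vector [A <> 0] satisfies
    [|A|_2 (sqrt d + 1) >= sqrt d + |A|_1] ([int_norm_bound]), with equality for
    [A = e_i] and [A = (1,...,1)]. A bounded full-dimensional polytope has at
    least [d + 1] facets ([card_facets]), and for each [i] some facet normal has
    a positive and some a negative [i]-th coordinate ([exists_facet_pos]), so
    that the [|A_F|_1] add up to at least [2 d]. Summing up,
    [(d-1)! F(P) >= sum_F |A_F|_2 >= d + sqrt d]
    ([surface_area_ge_simplex]).

    If [P = - P], project along [e_i]. The image of [P] contains the linear image
    of the [(d-1)]-dimensional cross-polytope under a nonsingular integer matrix,
    hence has volume at least [2^(d-1) / (d-1)!]. It is covered by the images of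
    the facets with [(u_F)_i > 0], as well as by those with [(u_F)_i < 0], and the
    image of [F] has volume [|(u_F)_i| vol F]. So
    [sum_F |(u_F)_i| vol F >= 2^d / (d-1)!] for each [i] ([projection_bound]), and
    adding over [i] with [|u_F|_1 <= sqrt d] gives
    [F(P) >= 2^d sqrt d / (d-1)!] ([surface_area_ge_cross_polytope]).

    Both arguments rest on two foundations. The first is the behaviour of the
    iterated integral [lebesgue_rV] under affine maps ([lebesgue_rV_affine]) and
    the volumes of simplices and cross-polytopes that follow from it. The second
    is the description of a polytope by its facets ([separating_facet], [hrep]),
    derived from Farkas' lemma: a hyperplane separating a point from the polytope
    can be moved until it contains [d] affinely independent vertices. The facets
    correspond to certain sets [J] of vertices ([surface_area_hull]), which also
    makes the two extremal surface areas computable. *)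

(** * Volume of sets of row vectors as a product measure *)

Section ProductSigmaFinite.
Context {R : realType} {d1 d2 : measure_display}.
Context {T1 : measurableType d1} {T2 : measurableType d2}.
Variables (m1 : {sigma_finite_measure set T1 -> \bar R})
  (m2 : {sigma_finite_measure set T2 -> \bar R}).

Lemma product_sigma_finite : sigma_finite setT (m1 \x m2)%E.
Proof.
have [F TF Foo] := sigma_finiteT m1; have [G TG Goo] := sigma_finiteT m2.
pose H (n : nat * nat) := F n.1 `*` G n.2.
exists (fun n => if unpickle n is Some p then H p else set0).
  apply/esym; rewrite -subTset => -[x y] _.
  have [i _ Fi] : (\bigcup_i F i) x by rewrite -TF.
  have [j _ Gj] : (\bigcup_i G i) y by rewrite -TG.
  by exists (pickle (i, j)) => //=; rewrite pickleK.
move=> n; case: unpickle => [[i j]|]; last by rewrite measure0; split.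
have [? ?] := Foo i; have [? ?] := Goo j; split; first exact: measurableX.
by rewrite product_measure1E// lte_mul_pinfty// ge0_fin_numE.
Qed.

(** The product is packed by hand because Tonelli's theorem, used below for each
    further coordinate, requires the measure on the remaining ones to be
    sigma-finite. *)
Definition sigma_finite_product :
    {sigma_finite_measure set (T1 * T2)%type -> \bar R} :=
  HB.pack (m1 \x m2)%E
    (@isSFinite.Build _ _ _ (m1 \x m2)%E
      (sfinite_measure_sigma_finite product_sigma_finite))
    (@isSigmaFinite.Build _ _ _ (m1 \x m2)%E product_sigma_finite).

End ProductSigmaFinite.

Section LebesgueRV.
Context {R : realType}.

(** Each dimension has its own measurable type, so that a recursion on the dimension
    has to produce the type together with its measure. *)
Record measure_space := MeasureSpace {
  space_display : measure_display;
  space_type : measurableType space_display;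
  space_measure : {sigma_finite_measure set space_type -> \bar R} }.

(** [lebesgue_rV] is an iterated lower integral of set functions. On the nested
    products [R * (R * ... )] the same iteration is a measure, and the
    measurability needed for additivity and for exchanging integrals is available
    there. *)
Fixpoint prod_space (n : nat) : measure_space :=
  match n with
  | 0 => @MeasureSpace _ unit (@dirac _ unit tt R)
  | m.+1 => @MeasureSpace _ (measurableTypeR R * space_type (prod_space m))%type
      (sigma_finite_product (@lebesgue_measure R) (space_measure (prod_space m)))
  end.

Notation TT n := (space_type (prod_space n)).
Notation mu n := (space_measure (prod_space n)).

Fixpoint to_rV (n : nat) : TT n -> 'rV[R]_n :=
  match n return TT n -> 'rV[R]_n with
  | 0 => fun _ => 0
  | m.+1 => fun p : measurableTypeR R * TT m => (row_mx (p.1)%:M (@to_rV m p.2) : 'rV_(1 + m))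
  end.

Fixpoint of_rV (n : nat) : 'rV[R]_n -> TT n :=
  match n return 'rV[R]_n -> TT n with
  | 0 => fun _ => tt
  | m.+1 => fun x : 'rV[R]_(1 + m) => (x 0 0, @of_rV m (rsubmx x))
  end.

Arguments to_rV : clear implicits.
Arguments of_rV : clear implicits.

Lemma of_rVK n : cancel (of_rV n) (to_rV n).
Proof.
elim: n => [|m IH] x /=; first by apply/rowP => -[].
rewrite IH -[RHS](@hsubmxK _ _ 1 m).
suff -> : (x 0 0)%:M = @lsubmx R 1 1 m x by [].
by apply/rowP => i; rewrite !mxE !ord1 /= mulr1n; congr (x _ _); apply/val_inj.
Qed.

Definition vmeas {n} (A : set 'rV[R]_n) := measurable (to_rV n @^-1` A).

Lemma vmeas_section {m} (A : set 'rV[R]_(1 + m)) t : @vmeas m.+1 A ->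
  @vmeas m [set y | A (row_mx t%:M y)].
Proof.
move=> mA; rewrite /vmeas.
have := @measurable_xsection _ _ _ _ _ t mA.
by congr (measurable _); apply/seteqP; split=> y; rewrite /xsection /= ?inE.
Qed.

Lemma lebesgue_rVE {n} (A : set 'rV[R]_n) : vmeas A ->
  lebesgue_rV A = mu n (to_rV n @^-1` A).
Proof.
elim: n A => [|m IH] A mA /=; first by rewrite diracE indicE; congr ((_ %:R)%:E);
  apply/idP/idP; rewrite !inE.
rewrite /product_measure1; apply: eq_integral => t _.
rewrite IH; last exact: (@vmeas_section m).
by congr (mu m _); apply/seteqP; split=> y; rewrite /xsection /= ?inE.
Qed.

(** By definition the first coordinate is integrated last; integrating it first
    instead is what makes the maps that alter only the first coordinate
    tractable. *)
Lemma lebesgue_rV_fubini m (A : set 'rV[R]_(1 + m)) : @vmeas m.+1 A ->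
  @lebesgue_rV R m.+1 A =
  (\int[mu m]_y lebesgue_measure [set t : measurableTypeR R | A (row_mx t%:M (to_rV m y))])%E.
Proof.
move=> mA; rewrite lebesgue_rVE //=.
have := @indic_fubini_tonelli _ _ _ _ _ (@lebesgue_measure R) (mu m) _ mA.
rewrite [X in X = _ -> _](_ : _ = space_measure (prod_space m.+1) (to_rV m.+1 @^-1` A)).
  move=> ->; apply: eq_integral => y _.
  rewrite indic_fubini_tonelli_GE //=; congr lebesgue_measure.
  by apply/seteqP; split=> t; rewrite /ysection /= ?inE.
by apply: eq_integral => t _; rewrite indic_fubini_tonelli_FE.
Qed.

End LebesgueRV.
Arguments to_rV {R} n _.
Arguments of_rV {R} n _.

(** By uniqueness of Lebesgue measure it suffices to compare the two sides on
    half-open intervals. *)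
Lemma lebesgue_measure_affine {R : realType} (a b : R) (A : set R) : a != 0 -> measurable A ->
  lebesgue_measure [set t : measurableTypeR R | A (a * t + b)] =
  (`|a|^-1%:E * lebesgue_measure A)%E.
Proof.
move=> a0 mA.
pose f (t : measurableTypeR R) : measurableTypeR R := a * t + b.
have mf : measurable_fun setT f.
  by apply: measurable_funD => //; apply: measurable_funM.
have na0 : 0 <= `|a| by [].
suff h : mscale (NngNum na0) (pushforward (@lebesgue_measure R) f) A = lebesgue_measure A.
- rewrite -h /mscale /=.
  have -> : pushforward lebesgue_measure f A = lebesgue_measure [set t : measurableTypeR
    R | A (a * t + b)] by [].
  by rewrite muleA -EFinM mulVf ?normr_eq0// mul1e.
move=> mf'; apply/esym/lebesgue_measure_unique => //= _ [[u v] /= uv] <-.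
rewrite /mscale /= /pushforward.
have [ag0|al0] := ltP 0 a.
  rewrite (_ : f @^-1` _ = `](u - b) / a, (v - b) / a]%classic); last first.
    apply/seteqP; split=> t /=;
      rewrite /f !in_itv /= ltr_pdivrMr// ler_pdivlMr// => /andP[h1 h2]; apply/andP; split; lra.
  rewrite !lebesgue_measure_itv /= !lte_fin.
  rewrite ltr_pM2r ?invr_gt0// ltrD2r; case: ifP => // _; last by rewrite mule0.
  by rewrite !EFinN -!EFinB -EFinM gtr0_norm//; congr (_%:E); field.
have {}al0 : a < 0 by rewrite lt_neqAle a0.
rewrite (_ : f @^-1` _ = `[(v - b) / a, (u - b) / a[%classic); last first.
  apply/seteqP; split=> t /=;
    rewrite /f !in_itv /= ltr_ndivlMr// ler_ndivrMr// => /andP[h1 h2]; apply/andP; split; lra.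
rewrite !lebesgue_measure_itv /= !lte_fin.
rewrite ltr_nM2r ?invr_lt0// ltrD2r; case: ifP => // _; last by rewrite mule0.
by rewrite !EFinN -!EFinB -EFinM ltr0_norm//; congr (_%:E); field.
Qed.

(** * Measurable sets of row vectors *)

Section AffineRV.
Context {R : realType}.
Notation TT n := (space_type (@prod_space R n)).
Notation mu n := (space_measure (@prod_space R n)).

Lemma measurable_coord n (i : 'I_n) :
  measurable_fun setT (fun p : TT n => to_rV n p 0 i : measurableTypeR R).
Proof.
elim: n i => [|m IH] i; first by case: i.
case: (@split_ordP 1 m i) => j ->.
  rewrite (_ : (fun p => _) = fst); first exact: measurable_fst.
  by apply/funext => -[t y]; rewrite (row_mxEl (t%:M : 'M[R]_1)) !ord1 mxE.
rewrite (_ : (fun p => _) = (fun y : TT m => to_rV m y 0 j) \o snd).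
  by apply: measurableT_comp (IH j) _; exact: measurable_snd.
by apply/funext => -[t y]; rewrite (row_mxEr (t%:M : 'M[R]_1)).
Qed.

Lemma measurable_of_rV d (T : measurableType d) n (g : T -> 'rV[R]_n) :
  (forall i, measurable_fun setT (fun p => g p 0 i : measurableTypeR R)) ->
  measurable_fun setT (fun p => of_rV n (g p)).
Proof.
elim: n g => [|m IH] g mg /=; first exact: measurable_cst.
apply: measurable_fun_pair; first exact: mg.
apply: IH => i; rewrite (_ : (fun p => _) = (fun p => g p 0 (rshift 1 i))) //.
by apply/funext => p; rewrite mxE.
Qed.

Lemma measurable_affine_coord n m (M : 'M[R]_(n, m)) (b : 'rV[R]_m) i :
  measurable_fun setT (fun p : TT n => (to_rV n p *m M + b) 0 i : measurableTypeR R).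
Proof.
rewrite (_ : (fun p => _) = (fun p : TT n => \sum_j to_rV n p 0 j * M j i + b 0 i)).
  apply: measurable_funD => //.
  apply: measurable_sum => j.
  by apply: measurable_funM => //; exact: measurable_coord.
by apply/funext => p; rewrite !mxE.
Qed.

Lemma vmeas_affine n m (M : 'M[R]_(n, m)) (b : 'rV[R]_m) (A : set 'rV[R]_m) :
  vmeas A -> vmeas [set x | A (x *m M + b)].
Proof.
move=> mA; have mf := measurable_of_rV (measurable_affine_coord M b).
have := mf measurableT _ mA; rewrite setTI /vmeas.
by congr (measurable _); apply/seteqP; split=> p /=; rewrite of_rVK.
Qed.

Lemma vmeas_halfspace n (a : 'rV[R]_n) (b : R) : vmeas [set x | dot x a <= b].
Proof.
have mf : measurable_fun setT (fun p : TT n => dot (to_rV n p) a : measurableTypeR R).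
  apply: measurable_sum => j.
  by apply: measurable_funM => //; exact: measurable_coord.
have := mf measurableT `]-oo, b]%classic (measurable_itv _); rewrite setTI /vmeas.
by congr (measurable _); apply/seteqP; split=> p /=; rewrite in_itv.
Qed.

Lemma vmeasI n (A B : set 'rV[R]_n) : vmeas A -> vmeas B -> vmeas (A `&` B).
Proof. by rewrite /vmeas preimage_setI; exact: measurableI. Qed.

Lemma vmeas_bigcap n (I : finType) (P : pred I) (F : I -> set 'rV[R]_n) :
  (forall i, P i -> vmeas (F i)) -> vmeas [set x | forall i, P i -> F i x].
Proof.
move=> mF; rewrite /vmeas.
rewrite (_ : _ @^-1` _ = \big[setI/setT]_(i <- index_enum I | P i) (to_rV n @^-1` F i)).
  by apply: bigsetI_measurable.
rewrite -bigcap_seq_cond; apply/seteqP; split=> p /= h i.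
  by case/andP=> _; exact: h.
by move=> Pi; apply: h => /=; rewrite mem_index_enum.
Qed.

Lemma lebesgue_rV_ge0 n (A : set 'rV[R]_n) : (0 <= lebesgue_rV A)%E.
Proof.
elim: n A => [|m IH] A /=; first by rewrite lee_fin indicE.
by apply: integral_ge0 => t _; exact: IH.
Qed.

Lemma le_lebesgue_rV n (A B : set 'rV[R]_n) : vmeas A -> vmeas B -> A `<=` B ->
  (lebesgue_rV A <= lebesgue_rV B)%E.
Proof.
move=> mA mB AB; rewrite !lebesgue_rVE//; apply: le_measure; rewrite ?inE//.
by move=> p /=; exact: AB.
Qed.

Lemma lebesgue_rV_subadditive n (I : finType) (P : pred I) (A : set 'rV[R]_n)
    (F : I -> set 'rV[R]_n) :
  vmeas A -> (forall i, P i -> vmeas (F i)) ->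
  (forall x, A x -> exists2 i, P i & F i x) ->
  (lebesgue_rV A <= \sum_(i | P i) lebesgue_rV (F i))%E.
Proof.
move=> mA mF AF; rewrite lebesgue_rVE//.
under eq_bigr => i Pi do rewrite (lebesgue_rVE (mF i Pi)).
pose G i := if P i then to_rV n @^-1` F i else set0.
have mG i : measurable (G i) by rewrite /G; case: ifPn => // /mF.
have AG : to_rV n @^-1` A `<=` \big[setU/set0]_(i <- index_enum I) G i.
  move=> p /AF[i Pi Fi]; rewrite -bigcup_seq; exists i => /=.
    by rewrite mem_index_enum.
  by rewrite /G Pi.
rewrite big_mkcond /=.
apply: le_trans (le_measure (mu n) _ _ AG) _; rewrite ?inE//.
  by apply: bigsetU_measurable.
elim: (index_enum I) => [|i s IH]; first by rewrite !big_nil measure0.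
rewrite !big_cons; apply: le_trans (measureU2 _ _ _) _ => //.
  by apply: bigsetU_measurable.
apply: leeD; last exact: IH.
by rewrite /G; case: ifP => // _; rewrite measure0.
Qed.

End AffineRV.

(** * Affine change of variables *)

Section ChangeOfVariables.
Context {R : realType}.
Notation TT n := (space_type (@prod_space R n)).
Notation mu n := (space_measure (@prod_space R n)).

Let invariant n (M : 'M[R]_n) (b : 'rV[R]_n) := forall A, vmeas A ->
  lebesgue_rV [set x | A (x *m M + b)] = (`|\det M|^-1%:E * lebesgue_rV A)%E.

Lemma invariant_mul n (M N : 'M[R]_n) b b' :
  invariant M b -> invariant N b' -> invariant (M *m N) (b *m N + b').
Proof.
move=> iM iN A mA.
rewrite (_ : [set x | _] = [set x | [set z | A (z *m N + b')] (x *m M + b)]); last first.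
  by apply/seteqP; split=> x /=; rewrite mulmxDl mulmxA addrA.
rewrite iM; last exact: vmeas_affine.
by rewrite iN// muleA -EFinM det_mulmx normrM invfM.
Qed.

Lemma measurable_lebesgue_rV_section m (A : set 'rV[R]_(1 + m)) : @vmeas R m.+1 A ->
  measurable_fun setT (fun t : measurableTypeR R => lebesgue_rV [set y : 'rV[R]_m | A
    (row_mx t%:M y)]).
Proof.
move=> mA; have := @measurable_fun_xsection _ _ _ _ _ (mu m) _ mA.
apply: eq_measurable_fun => t _ /=.
rewrite lebesgue_rVE; last exact: vmeas_section.
by congr (mu m _); apply/seteqP; split=> y; rewrite /xsection /= ?inE.
Qed.

(** For a fixed first coordinate [t], the map acts on the other coordinates by [N]
    followed by a translation depending on [t]; the inner volume scales by a
    constant. *)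
Lemma invariant_inner m (r : 'rV[R]_m) (N : 'M[R]_m) : (forall b, invariant N b) ->
  forall b : 'rV[R]_m,
  @invariant m.+1 (block_mx 1%:M r 0 N : 'M[R]_(1 + m)) (row_mx 0 b : 'rV[R]_(1 + m)).
Proof.
move=> iN b A mA.
rewrite (det_ublock (1%:M : 'M[R]_1)) det1 mul1r /=.
rewrite -ge0_integralZl ?lee_fin ?invr_ge0//; last 2 first.
- exact: measurable_lebesgue_rV_section.
- by move=> t _; exact: lebesgue_rV_ge0.
apply: eq_integral => t _.
rewrite -(iN (t%:M *m r + b)); last exact: vmeas_section.
have E (y : 'rV[R]_m) : (row_mx t%:M y : 'rV[R]_(1 + m)) *m block_mx 1%:M r 0 N + row_mx 0 b
         = row_mx t%:M (y *m N + (t%:M *m r + b)).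
  by rewrite mul_row_block mulmx1 mulmx0 addr0 add_row_mx addr0 addrA (addrC (y *m N)).
by congr lebesgue_rV; apply/seteqP; split=> y /=; rewrite E.
Qed.

(** For fixed last coordinates, the map acts on the first one by scaling and
    translation, so the one-dimensional change of variables applies once the
    first coordinate is integrated first. *)
Lemma invariant_outer m (a : R) (c : 'cV[R]_m) : a != 0 ->
  forall b : R,
  @invariant m.+1 (block_mx a%:M 0 c 1%:M : 'M[R]_(1 + m)) (row_mx b%:M 0 : 'rV[R]_(1 + m)).
Proof.
move=> a0 b A mA.
rewrite (det_lblock (a%:M : 'M[R]_1)) det1 mulr1 det_scalar1.
rewrite lebesgue_rV_fubini; last exact: (@vmeas_affine R m.+1 m.+1).
rewrite lebesgue_rV_fubini //.
have mS (y : TT m) : measurable [set t : measurableTypeR R | A (row_mx t%:M (to_rV m y))].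
  have := @measurable_ysection _ _ _ _ _ y mA.
  by congr (measurable _); apply/seteqP; split=> t; rewrite /ysection /= ?inE.
rewrite -ge0_integralZl ?lee_fin ?invr_ge0//; last first.
- have := @measurable_fun_ysection _ _ _ _ _ (@lebesgue_measure R) _ mA.
  apply: eq_measurable_fun => y _ /=; congr lebesgue_measure.
  by apply/seteqP; split=> t; rewrite /ysection /= ?inE.
apply: eq_integral => y _.
rewrite -(lebesgue_measure_affine ((to_rV m y *m c) 0 0 + b)) //.
set q := (to_rV m y *m c) 0 0.
have E t : (row_mx t%:M (to_rV m y) : 'rV[R]_(1 + m)) *m block_mx a%:M 0 c 1%:M + row_mx b%:M 0
         = row_mx (a * t + (q + b))%:M (to_rV m y).
  rewrite mul_row_block mulmx0 mulmx1 add0r add_row_mx addr0.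
  rewrite -scalar_mxM [to_rV m y *m c]mx11_scalar -/q -!raddfD /=.
  by rewrite addrA mulrC.
by congr lebesgue_measure; apply/seteqP; split=> t /=; rewrite E.
exact: mS.
Qed.

(** Induction on the dimension. A matrix whose corner entry is nonzero factors as
    [[a, 0; c, 1] [1, r; 0, N]], one factor of each of the two kinds above, with
    [N] one size smaller. A zero corner entry is made nonzero by a shear, which is
    of the second kind with [N = 1]. *)
Lemma lebesgue_rV_affine n (M : 'M[R]_n) (b : 'rV[R]_n) (A : set 'rV[R]_n) :
  M \in unitmx -> vmeas A ->
  lebesgue_rV [set x | A (x *m M + b)] = (`|\det M|^-1%:E * lebesgue_rV A)%E.
Proof.
move=> + mA; move: b A mA.
suff : M \in unitmx -> forall b, invariant M b by move=> h b A mA uM; exact: h.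
elim: n M => [|m IH] M uM b.
  move=> A _; rewrite det_mx00 normr1 invr1 mul1e; congr lebesgue_rV.
  by apply/seteqP; split=> x /=; rewrite [x *m M + b]thinmx0 [x]thinmx0.
move: M b uM; suff pos (M : 'M[R]_(1 + m)) : M \in unitmx -> M 0 0 != 0 -> forall b,
  @invariant m.+1 M b.
  move=> M b uM; have [M0|] := eqVneq (M 0 0) 0; last by move=> M0; exact: pos.
  have [i Mi] : exists i : 'I_m, M (rshift 1 i) 0 != 0.
    apply/existsP; apply: contraT => /existsPn h; move: uM.
    rewrite unitmxE (expand_det_col _ 0) big1 ?unitr0// => i _.
    case: (@split_ordP 1 m i) => j ->; last by rewrite (eqP (negPn (h j))) mul0r.
    have -> : lshift m j = 0 by apply/val_inj; rewrite /= ord1.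
    by rewrite M0 mul0r.
  (* [S 1] adds row [i] of the lower block to the first row. *)
  pose S (s : R) : 'M[R]_(1 + m) := block_mx 1%:M (s *: delta_mx 0 i) 0 1%:M.
  have SS : S (-1) *m S 1 = 1%:M.
    rewrite /S mulmx_block !mulmx1 !mulmx0 !mul0mx !mul1mx !addr0 !add0r scaleN1r scale1r.
    by rewrite subrr -scalar_mx_block.
  have iS : @invariant m.+1 (S (-1)) 0.
    have -> : 0 = row_mx 0 0 :> 'rV[R]_(1 + m) by rewrite row_mx0.
    by apply: invariant_inner; apply: IH; rewrite unitmx1.
  have SM0 (Q : 'M[R]_(1 + m)) : Q 0 0 = 0 -> (S 1 *m Q) 0 0 = Q (rshift 1 i) 0.
    move=> Q0.
    have l0 : 0 = lshift m (0 : 'I_1) by exact: val_inj.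
    rewrite -{1}[Q]submxK /S mulmx_block !mul1mx scale1r -rowE {1 2}l0.
    by rewrite block_mxEul !mxE -l0 Q0 add0r.
  have uS1 : S 1 \in unitmx by rewrite unitmxE det_ublock !det1 mulr1 unitr1.
  have -> : M = S (-1) *m (S 1 *m M) by rewrite mulmxA SS mul1mx.
  have -> : b = 0 *m (S 1 *m M) + b by rewrite mul0mx add0r.
  apply: invariant_mul iS (pos _ _ _ _); first by rewrite unitmx_mul uS1.
  by rewrite (SM0 M M0).
move=> uM M0 b0; pose b : 'rV[R]_(1 + m) := b0; rewrite (_ : b0 = b) //; move: b => {b0} b.
set a := M 0 0 in M0.
pose c := dlsubmx M; pose r := a^-1 *: ursubmx M; pose N := drsubmx M - c *m r.
have ME : M = block_mx a%:M 0 c 1%:M *m block_mx 1%:M r 0 N.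
  rewrite mulmx_block !mulmx1 !mulmx0 !mul0mx !mul1mx !addr0 mul_scalar_mx.
  rewrite /r scalerA mulfV // scale1r /N addrC subrK -[LHS]submxK.
  suff -> : ulsubmx M = a%:M by [].
  by apply/matrixP => i j; rewrite !mxE !ord1 mulr1n; congr (M _ _); exact: val_inj.
have uN : N \in unitmx.
  move: uM; rewrite ME unitmx_mul => /andP[_].
  by rewrite !unitmxE det_ublock det1 mul1r.
have -> : b = row_mx (b 0 0)%:M 0 *m block_mx 1%:M r 0 N + row_mx 0 (rsubmx b - b 0 0 *: r).
  rewrite mul_row_block !mulmx1 !mulmx0 !mul0mx !addr0 mul_scalar_mx add_row_mx addr0.
  rewrite addrC subrK -[LHS]hsubmxK.
  suff -> : lsubmx b = (b 0 0)%:M by [].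
  by apply/rowP => i; rewrite !mxE !ord1 mulr1n; congr (b _ _); exact: val_inj.
rewrite ME; apply: invariant_mul; first exact: invariant_outer.
by apply: invariant_inner; exact: IH.
Qed.
End ChangeOfVariables.

(** * Volumes of the standard simplex and the cross-polytope *)

Section StandardVolumes.
Context {R : realType}.
Notation TT n := (space_type (@prod_space R n)).
Implicit Types (n m : nat) (s : R).

Definition corner n s : set 'rV[R]_n :=
  [set y | (forall i, 0 <= y 0 i) /\ \sum_i y 0 i <= s].

Definition l1ball n s : set 'rV[R]_n := [set y | \sum_i `|y 0 i| <= s].

Lemma vmeas_le n (g : 'rV[R]_n -> R) (b : R) :
  measurable_fun setT (fun p : TT n => g (to_rV n p) : measurableTypeR R) ->
  vmeas [set x | g x <= b].
Proof.
move=> mg; have := mg measurableT `]-oo, b]%classic (measurable_itv _).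
rewrite setTI /vmeas.
by congr (measurable _); apply/seteqP; split=> p /=; rewrite in_itv.
Qed.

Lemma vmeas_l1ball n s : vmeas (@l1ball n s).
Proof.
apply: vmeas_le; apply: measurable_sum => j.
by apply: measurableT_comp (measurable_coord _) => //; exact: measurable_normr.
Qed.

Lemma vmeas_corner n s : vmeas (@corner n s).
Proof.
have -> : @corner n s = [set y | forall i : 'I_n, predT i -> [set y : 'rV[R]_n | - y 0 i <= 0] y]
    `&` [set y | \sum_i y 0 i <= s].
  by apply/seteqP; split=> y [h1 h2]; split=> // i; have := h1 i; rewrite /= oppr_le0// => ->.
apply: vmeasI.
  apply: vmeas_bigcap => i _; apply: (@vmeas_le _ (fun y => - y 0 i)).
  by apply: measurableT_comp (measurable_coord _) => //; exact: measurable_funN.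
apply: (@vmeas_le _ (fun y => \sum_i y 0 i)); apply: measurable_sum => j.
exact: measurable_coord.
Qed.

Lemma integral_deriv_poly (p : {poly R}) (a b : R) : a <= b ->
  (\int[@lebesgue_measure R]_(t in `[a, b]) (p^`().[t])%:E = (p.[b] - p.[a])%:E)%E.
Proof.
rewrite le_eqVlt => /predU1P[->|ab].
  by rewrite set_itv1 integral_set1 subrr.
rewrite (@continuous_FTC2 _ (horner p^`()) (horner p)) //.
- by apply: continuous_subspaceT; exact: continuous_horner.
- split.
  + by move=> x _; exact: derivable_horner.
  + exact/cvg_at_right_filter/continuous_horner.
  + exact/cvg_at_left_filter/continuous_horner.
- by move=> x _; rewrite derivE.
Qed.

Lemma integral_monomial (s c : R) m : 0 <= s ->
  (\int[@lebesgue_measure R]_(t in `[0%R, s]) (c * (s - t) ^+ m)%:E =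
   (c * s ^+ m.+1 / m.+1%:R)%:E)%E.
Proof.
move=> s0; pose p : {poly R} := - (c / m.+1%:R) *: (s%:P - 'X) ^+ m.+1.
have dp t : p^`().[t] = c * (s - t) ^+ m.
  rewrite /p derivZ deriv_exp derivB derivC derivX sub0r /= hornerZ hornerMn hornerM
    horner_exp !hornerE -mulr_natr.
  by field; rewrite ?natr1 ?nat1r pnatr_eq0.
under eq_integral do rewrite -dp.
rewrite integral_deriv_poly // /p !hornerZ !horner_exp !hornerE subrr subr0 expr0n /= mulr0 sub0r.
by congr (_%:E); rewrite mulNr opprK mulrAC.
Qed.

Lemma corner_row_mx m s t (y : 'rV[R]_m) :
  @corner (1 + m) s (row_mx t%:M y) <-> 0 <= t /\ corner (s - t) y.
Proof.
rewrite /corner /= big_split_ord /= big_ord1 row_mxEl mxE mulr1n.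
under eq_bigr do rewrite row_mxEr.
rewrite -lerBrDl; split=> [[h1 h2]|[h0 [h1 h2]]].
  split; first by have := h1 (lshift m 0); rewrite row_mxEl mxE mulr1n.
  by split=> // i; have := h1 (rshift 1 i); rewrite row_mxEr.
split=> // i; case: (@split_ordP 1 m i) => j ->; last by rewrite row_mxEr.
by rewrite row_mxEl ord1 mxE mulr1n.
Qed.

Lemma corner_lt0 n s : s < 0 -> @corner n s = set0.
Proof.
move=> s0; apply/seteqP; split=> // y [y0 ys].
by have := le_lt_trans ys s0; rewrite ltNge sumr_ge0.
Qed.

Lemma lebesgue_rV_set0 n : lebesgue_rV (set0 : set 'rV[R]_n) = 0%E.
Proof.
elim: n => [|m IH] /=; first by rewrite indic0.
by apply: integral0_eq => t _; exact: IH.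
Qed.

(** The slice at height [t] is a corner of size [s - t] in one dimension less. *)
Lemma lebesgue_rV_corner n s : 0 <= s ->
  lebesgue_rV (@corner n s) = (s ^+ n / n`!%:R)%:E.
Proof.
elim: n s => [|m IH] s s0 /=.
  rewrite expr0 fact0 divr1 indicE mem_set//; split; first by case.
  by rewrite big_ord0.
have E t : lebesgue_rV [set y : 'rV[R]_m | @corner m.+1 s (row_mx t%:M y)] =
    ((fun t => (m`!%:R^-1 * (s - t) ^+ m)%:E) \_ `[0%R, s]) t.
  rewrite patchE mem_setE in_itv /=.
  have -> : [set y : 'rV[R]_m | @corner m.+1 s (row_mx t%:M y)] =
            [set y | 0 <= t /\ corner (s - t) y].
    by apply/seteqP; split=> y /= /corner_row_mx.
  have [t0|t0] /= := leP 0 t; last first.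
    by rewrite (_ : [set y | _] = set0) ?lebesgue_rV_set0//; apply/seteqP; split=> y // -[].
  rewrite (_ : [set y | _] = corner (s - t)); last by apply/seteqP; split=> y //= -[].
  have [ts|ts] := leP t s; first by rewrite IH ?subr_ge0// mulrC.
  by rewrite corner_lt0 ?subr_lt0// lebesgue_rV_set0.
under eq_integral => t _ do rewrite E.
rewrite -integral_mkcond integral_monomial//; congr (_%:E).
rewrite factS natrM.
by field; rewrite ?natr1 ?nat1r !pnatr_eq0 -lt0n fact_gt0.
Qed.

Lemma l1ball_row_mx m s t (y : 'rV[R]_m) :
  @l1ball (1 + m) s (row_mx t%:M y) <-> l1ball (s - `|t|) y.
Proof.
rewrite /l1ball /= big_split_ord /= big_ord1 row_mxEl mxE mulr1n.
under eq_bigr do rewrite row_mxEr.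
by rewrite -lerBrDl.
Qed.

Lemma l1ball_lt0 n s : s < 0 -> @l1ball n s = set0.
Proof.
move=> s0; apply/seteqP; split=> // y; rewrite /l1ball /= => ys.
by have := le_lt_trans ys s0; rewrite ltNge sumr_ge0.
Qed.

Lemma integral_even (s : R) (f : R -> R) : 0 <= s -> continuous f -> (forall t, 0 <= f t) ->
  (forall t, f (- t) = f t) ->
  (\int[@lebesgue_measure R]_(t in `[(- s)%R, s]) (f t)%:E =
   2%:E * \int[@lebesgue_measure R]_(t in `[0%R, s]) (f t)%:E)%E.
Proof.
move=> s0 cf f0 fN.
have mf D : measurable_fun D (EFin \o f).
  by apply/measurable_EFinP/measurable_funTS; exact: continuous_measurable_fun.
have -> : `[- s, s]%classic = `[- s, 0[%classic `|` `[0, s]%classic.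
  rewrite -itv_bndbnd_setU //= bnd_simp; lra.
rewrite ge0_integral_setU //; last 2 first.
- by move=> x _; rewrite lee_fin.
- by apply/disj_setPS => x [] /=; rewrite !in_itv /= => /andP[_ h1] /andP[h2 _]; lra.
rewrite integral_itv_bndo_bndc //.
have -> : `[- s, 0]%classic = `[- s, - 0]%classic by rewrite oppr0.
rewrite integration_by_substitution_oppr //; last exact: continuous_subspaceT.
rewrite mule_natl mule2n; congr (_ + _)%E.
by apply: eq_integral => t _ /=; rewrite fN.
exact: mf.
Qed.

(** The slice at height [t] is an l1-ball of radius [s - |t|] in one dimension
    less; by symmetry the integral over [[-s, s]] is twice that over [[0, s]]. *)
Lemma lebesgue_rV_l1ball n s : 0 <= s ->
  lebesgue_rV (@l1ball n s) = ((2 * s) ^+ n / n`!%:R)%:E.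
Proof.
elim: n s => [|m IH] s s0 /=.
  by rewrite expr0 fact0 divr1 indicE mem_set//; rewrite /l1ball /= big_ord0.
(* The absolute value around the slice radius makes the integrand nonnegative
   and continuous on the whole line. *)
pose f (t : R) := 2 ^+ m / m`!%:R * `|s - `|t| | ^+ m.
have E t : lebesgue_rV [set y : 'rV[R]_m | @l1ball m.+1 s (row_mx t%:M y)] =
    ((fun t => (f t)%:E) \_ `[- s, s]) t.
  rewrite patchE mem_setE in_itv /= -ler_norml.
  have -> : [set y : 'rV[R]_m | @l1ball m.+1 s (row_mx t%:M y)] = l1ball (s - `|t|).
    by apply/seteqP; split=> y /= /l1ball_row_mx.
  case: leP => ts; last by rewrite l1ball_lt0 ?subr_lt0// lebesgue_rV_set0.
  rewrite IH ?subr_ge0// /f [`|s - _|]ger0_norm ?subr_ge0//.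
  by rewrite exprMn mulrAC.
under eq_integral => t _ do rewrite E.
rewrite -integral_mkcond integral_even //; last 3 first.
- move=> t; apply: cvgM; first exact: cvg_cst.
  apply: (@continuous_comp _ _ _ (fun t => `|s - `|t| |) (fun x => x ^+ m));
    last exact: exprn_continuous.
  apply: cvg_norm; apply: cvgB; first exact: cvg_cst.
  exact: norm_continuous.
- by move=> t; rewrite /f !mulr_ge0 ?invr_ge0 ?exprn_ge0.
- by move=> t; rewrite /f normrN.
under eq_integral.
  move=> t; rewrite inE /= in_itv /= => /andP[t0 ts].
  rewrite /f [`|t|]ger0_norm// ger0_norm ?subr_ge0//.
  over.
rewrite integral_monomial// -EFinM; congr (_%:E).
rewrite factS natrM exprMn !exprS.
by field; rewrite ?natr1 ?nat1r !pnatr_eq0 -lt0n fact_gt0.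
Qed.

End StandardVolumes.

(** * Convex hulls of finite families and volumes of simplices *)

Section Conv.
Context {R : realType}.

(** Weights on the whole index type that vanish outside [J], rather than weights
    indexed by [J], make hulls for different [J] easy to compare. *)
Definition hull d (I : finType) (v : I -> 'rV[R]_d) (J : {set I}) : set 'rV[R]_d :=
  [set x | exists w : I -> R, [/\ forall i, 0 <= w i, forall i, i \notin J -> w i = 0,
     \sum_i w i = 1 & x = \sum_i w i *: v i]].

Lemma conv_hullE d (I : finType) (v : I -> 'rV[R]_d) (J : {set I}) :
  conv_hull (v @` [set i | i \in J]) = hull v J.
Proof.
apply/seteqP; split=> x.
  case=> n [u [w [uA w0 w1 ->]]].
  have /choice[g gP] : forall k, exists i, i \in J /\ v i = u k.
    by move=> k; have [i /= iJ <-] := uA k; exists i.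
  exists (fun i => \sum_(k | g k == i) w k); split.
  - by move=> i; apply: sumr_ge0.
  - move=> i iJ; rewrite big1// => k /eqP gk.
    by move: iJ; rewrite -gk (gP k).1.
  - by rewrite -w1 (partition_big g predT).
  - rewrite (partition_big g predT)//=; apply: eq_bigr => i _.
    by rewrite scaler_suml; apply: eq_bigr => k /eqP <-; rewrite (gP k).2.
case=> w [w0 wJ w1 ->].
exists #|J|, (fun k => v (enum_val k)), (fun k => w (enum_val k)); split => //.
- by move=> k; exists (enum_val k) => //=; exact: enum_valP.
- rewrite -(big_enum_val w) /= -w1 [RHS](bigID (mem J)) /= [X in _ = _ + X]big1 ?addr0//.
- rewrite -(big_enum_val (fun i => w i *: v i)) /= [LHS](bigID (mem J)) /= [X in _ +
  X]big1 ?addr0//.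
  by move=> i /wJ ->; rewrite scale0r.
Qed.

(** Row [j] is the point [v j] in homogeneous coordinates, so that affine
    independence of the points is linear independence of the rows. *)
Definition homog n d (v : 'I_n -> 'rV[R]_d) : 'M[R]_(n, 1 + d) :=
  \matrix_(j < n) (row_mx 1%:M (v j) : 'rV[R]_(1 + d)).

Lemma det_homog k (y : 'I_k.+1 -> 'rV[R]_k) :
  \det (homog y) = \det (\matrix_(j < k) (y (lift 0 j) - y 0)).
Proof.
set D := \matrix_(j < k) _.
have -> : homog y = (block_mx 1%:M 0 (const_mx 1) 1%:M : 'M[R]_(1 + k)) *m block_mx 1%:M (y 0) 0 D.
  rewrite mulmx_block !mul1mx !mul0mx !mulmx1 !addr0.
  apply/row_matrixP => i; rewrite rowK.
  case: (@split_ordP 1 k i) => j ->.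
    by rewrite (@rowKu _ 1 k); rewrite ord1 (_ : lshift k 0 = 0) ?row_id //; exact: val_inj.
  rewrite (@rowKd _ 1 k) row_row_mx.
  have -> : row j (const_mx 1 : 'cV[R]_k) = 1%:M by apply/rowP => l; rewrite !mxE ord1.
  suff -> : y (rshift 1 j) = row j (const_mx 1 *m y 0 + D) by [].
  apply/rowP => l; rewrite !mxE big_ord1 !mxE mul1r.
  have -> : rshift 1 j = lift ord0 j by apply/val_inj.
  set p := y _ 0 l; set q := y 0 0 l; by rewrite addrC subrK.
rewrite (@det_mulmx _ (1 + k)) (@det_lblock _ 1 k) (@det_ublock _ 1 k).
by rewrite !det1 !mul1r.
Qed.

(** A simplex is an affine image of the standard corner: the barycentric
    coordinates other than the first are the coordinates in the corner. *)
Lemma simplex_preimage k (y : 'I_k.+1 -> 'rV[R]_k) (D := \matrix_(j < k) (y (lift 0 j) - y 0)) :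
  D \in unitmx ->
  hull y [set: 'I_k.+1]%SET = [set z | corner 1 (z *m invmx D + - (y 0 *m invmx D))].
Proof.
move=> uD; have sD (s : 'rV[R]_k) : s *m D = \sum_j s 0 j *: (y (lift 0 j) - y 0).
  by rewrite mulmx_sum_row; apply: eq_bigr => j _; rewrite rowK.
apply/seteqP; split=> z /=.
  case=> w [w0 _ w1 ->].
  pose s : 'rV[R]_k := \row_j w (lift 0 j).
  suff -> : (\sum_i w i *: y i) *m invmx D + - (y 0 *m invmx D) = s.
    split; first by move=> i; rewrite mxE.
    by rewrite -w1 big_ord_recl ler_wpDl//; under eq_bigr do rewrite mxE.
  rewrite -mulmxBl; apply/(canLR (mulmxK uD)).
  rewrite sD big_ord_recl -[X in _ - X]scale1r -w1 big_ord_recl scalerDl.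
  rewrite opprD addrACA subrr add0r scaler_suml -sumrB.
  by apply: eq_bigr => j _; rewrite mxE scalerBr.
rewrite -mulmxBl; set s := (z - y 0) *m _ => -[s0 s1].
exists (fun i => if unlift 0 i is Some j then s 0 j else 1 - \sum_j s 0 j); split.
- by move=> i; case: unliftP => [j|] _ //; rewrite subr_ge0.
- by move=> i; rewrite inE.
- rewrite big_ord_recl unlift_none [X in _ + X](eq_bigr (fun i => s 0 i)) ?subrK// => i _.
  by rewrite liftK.
rewrite big_ord_recl unlift_none.
rewrite [X in _ + X](eq_bigr (fun i => s 0 i *: y (lift 0 i))); last first.
  by move=> i _; rewrite liftK.
have : s *m D = z - y 0 by rewrite /s mulmxKV.
rewrite sD => /esym/eqP; rewrite subr_eq => /eqP ->.
rewrite [X in X + _ = _](eq_bigr (fun j => s 0 j *: y (lift 0 j) - s 0 j *: y 0)); last first.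
  by move=> j _; rewrite scalerBr.
by rewrite sumrB -scaler_suml scalerBl scale1r addrC [RHS]addrAC addrA.
Qed.

Lemma vmeas_simplex k (y : 'I_k.+1 -> 'rV[R]_k) :
  \det (homog y) != 0 -> vmeas (hull y [set: 'I_k.+1]%SET).
Proof.
rewrite det_homog => D0; rewrite simplex_preimage ?unitmxE ?unitfE//.
exact/vmeas_affine/vmeas_corner.
Qed.

Lemma lebesgue_rV_simplex k (y : 'I_k.+1 -> 'rV[R]_k) :
  \det (homog y) != 0 ->
  lebesgue_rV (hull y [set: 'I_k.+1]%SET) = (`|\det (homog y)| / k`!%:R)%:E.
Proof.
rewrite det_homog => D0; have uD := D0; rewrite -unitfE -unitmxE in uD.
rewrite simplex_preimage// lebesgue_rV_affine ?unitmx_inv//; last exact: vmeas_corner.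
by rewrite lebesgue_rV_corner// expr1n det_inv normrV// invrK -EFinM div1r.
Qed.

End Conv.

(** * Farkas' lemma *)

Section Farkas.
Context {R : realType} {n : nat}.
Implicit Types (x a c : 'rV[R]_n) (s : seq 'rV[R]_n).

Lemma dotE x a : dot x a = (x *m a^T) 0 0.
Proof. by rewrite mxE; apply: eq_bigr => i _; rewrite mxE. Qed.
Lemma dotDl x y a : dot (x + y) a = dot x a + dot y a.
Proof. by rewrite !dotE mulmxDl mxE. Qed.
Lemma dotDr x a c : dot x (a + c) = dot x a + dot x c.
Proof. by rewrite !dotE linearD mulmxDr mxE. Qed.
Lemma dotZl t x a : dot (t *: x) a = t * dot x a.
Proof. by rewrite !dotE -scalemxAl mxE. Qed.
Lemma dotZr t x a : dot x (t *: a) = t * dot x a.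
Proof. by rewrite !dotE linearZ /= -scalemxAr mxE. Qed.
Lemma dotNl x a : dot (- x) a = - dot x a.
Proof. by rewrite -scaleN1r dotZl mulN1r. Qed.
Lemma dotNr x a : dot x (- a) = - dot x a.
Proof. by rewrite -scaleN1r dotZr mulN1r. Qed.
Lemma dot0l a : dot 0 a = 0.
Proof. by rewrite dotE mul0mx mxE. Qed.
Lemma dot0r x : dot x 0 = 0.
Proof. by rewrite dotE trmx0 mulmx0 mxE. Qed.
Lemma dotC x a : dot x a = dot a x.
Proof. by apply: eq_bigr => i _; rewrite mulrC. Qed.
Lemma dot_suml (I : finType) (P : pred I) (F : I -> 'rV[R]_n) a :
  dot (\sum_(i | P i) F i) a = \sum_(i | P i) dot (F i) a.
Proof. by elim/big_rec2 : _ => [|i y z _ <-]; rewrite ?dot0l// dotDl. Qed.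
Lemma dot_ge0 x : 0 <= dot x x.
Proof. by apply: sumr_ge0 => i _; rewrite -expr2 sqr_ge0. Qed.
Lemma dot_eq0 x : (dot x x == 0) = (x == 0).
Proof.
apply/idP/eqP => [|->]; last by rewrite dot0l.
rewrite psumr_eq0 => [/allP h|i _]; last by rewrite -expr2 sqr_ge0.
apply/rowP => i; rewrite mxE.
by have := h i (mem_index_enum _); rewrite /= -expr2 sqrf_eq0 => /eqP.
Qed.

(** Membership in the cone generated by [s], peeling off one generator at a time,
    the form that suits the induction in Farkas' lemma. *)
Fixpoint cone s x : Prop :=
  if s is a :: s' then exists2 t, 0 <= t & cone s' (x - t *: a) else x = 0.

(** A combination of the [y - g y *: a] is the same combination of the [y] plus a
    multiple of [a], and that multiple is nonnegative as [g <= 0]. *)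
Lemma cone_shear s a (g : 'rV[R]_n -> R) x : {in s, forall y, g y <= 0} ->
  cone [seq y - g y *: a | y <- s] x -> exists2 t, 0 <= t & cone s (x - t *: a).
Proof.
elim: s x => [|y s IH] x g0 /=.
  by move=> ->; exists 0; rewrite ?scale0r ?subr0.
case=> t t0 /IH[|r r0 h].
  by move=> z zs; apply: g0; rewrite inE zs orbT.
exists (r - t * g y).
  by rewrite addr_ge0// oppr_ge0 mulr_ge0_le0// g0// mem_head.
exists t => //; move: h; congr cone.
by apply/rowP => i; rewrite !mxE; ring.
Qed.

(** Induction on the number of generators. If the functional [c] found for the
    tail [s] is negative at the head [a], project everything along [a] onto the
    kernel of [c] and apply the induction hypothesis there: a nonnegative
    combination of the projected generators lifts, with a nonnegative coefficient
    at [a], and a separating functional [c'] lifts to one that vanishes at [a]. *)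
Lemma farkas s x :
  cone s x \/ exists c, {in s, forall a, 0 <= dot a c} /\ dot x c < 0.
Proof.
move: {2}(size s) (erefl (size s)) => m; elim: m s x => [|m IH] [|a s] x //= => [_|[sz]].
  have [->|x0] := eqVneq x 0; first by left.
  right; exists (- x); split => //.
  by rewrite dotNr oppr_lt0 lt_neqAle eq_sym dot_eq0 x0 dot_ge0.
have [h|[c [c0 cx]]] := IH s x sz.
  by left; exists 0; rewrite ?scale0r ?subr0.
have [ac|ac] := leP 0 (dot a c).
  by right; exists c; split=> // y; rewrite inE => /predU1P[->|/c0].
pose g y := dot y c / dot a c.
have [|h|[c' [c'0 c'x]]] := IH [seq y - g y *: a | y <- s] (x - g x *: a).
- by rewrite size_map.
- left; have [|t t0 {}h] := cone_shear _ h.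
    by move=> y ys; rewrite /g mulr_ge0_le0 ?c0// invr_le0 ltW.
  exists (g x + t).
    by rewrite addr_ge0// /g mulr_le0// ?invr_le0 ltW.
  by move: h; congr cone; apply/rowP => i; rewrite !mxE; ring.
right; exists (c' - (dot a c' / dot a c) *: c).
have E y : dot y (c' - (dot a c' / dot a c) *: c) = dot (y - g y *: a) c'.
  rewrite !dotDr !dotDl !dotNl !dotNr !dotZl !dotZr /g.
  by field; rewrite lt_eqF.
split; last by rewrite E.
move=> y; rewrite inE => /predU1P[->|ys]; rewrite E.
  by rewrite /g divff ?lt_eqF// scale1r subrr dot0l.
by apply: c'0; apply/mapP; exists y.
Qed.

Lemma cone_sum (I : finType) (v : I -> 'rV[R]_n) (r : seq I) x : uniq r ->
  cone [seq v i | i <- r] x -> exists2 w : I -> R, (forall i, 0 <= w i) &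
    (forall i, i \notin r -> w i = 0) /\ x = \sum_i w i *: v i.
Proof.
elim: r x => [|j r IH] x /=.
  by move=> _ ->; exists (fun=> 0) => //; split=> //; rewrite big1// => i _; rewrite scale0r.
case/andP=> jr /IH{}IH [t t0 /IH[w w0 [wr /eqP]]].
rewrite subr_eq => /eqP ->.
exists (fun i => if i == j then t else w i); first by move=> i; case: eqP.
split.
  by move=> i; rewrite inE negb_or => /andP[/negPf ->]; exact: wr.
rewrite addrC [RHS](bigD1 j)//= eqxx; congr (_ + _).
rewrite (bigD1 j)//= wr// scale0r add0r; apply: eq_bigr => i /negPf ij.
by rewrite ij.
Qed.

End Farkas.

(** * Separation by hyperplanes spanned by vertices *)

Section Facets.
Context {R : realType} {d : nat}.
Implicit Types (x u p : 'rV[R]_d) (b : R).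

Definition hat x : 'rV[R]_(1 + d) := row_mx 1%:M x.
(** The column such that [hat x *m slack u b] is [b - dot x u]: it vanishes on the
    hyperplane [dot x u = b] and is nonnegative where [dot x u <= b]. *)
Definition slack u b : 'cV[R]_(1 + d) := col_mx b%:M (- u^T).

Lemma hat_slack x u b : hat x *m slack u b = (b - dot x u)%:M.
Proof.
rewrite mul_row_col mul1mx mulmxN; apply/matrixP => i j; rewrite !ord1 !mxE eqxx !mulr1n.
by congr (_ - _); apply: eq_bigr => k _; rewrite mxE.
Qed.

Lemma slackN u b : slack (- u) (- b) = - slack u b.
Proof. by rewrite /slack opp_col_mx raddfN /= linearN. Qed.

Lemma homog_slack n (v : 'I_n -> 'rV[R]_d) u b :
  homog v *m slack u b = \col_i (b - dot (v i) u).
Proof.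
apply/row_matrixP => i; rewrite row_mul rowK hat_slack.
by apply/rowP => j; rewrite !mxE ord1 mulr1n.
Qed.

Lemma slack_surj (c : 'cV[R]_(1 + d)) : exists u b, c = slack u b.
Proof.
exists (- (dsubmx c)^T), (usubmx c 0 0); rewrite /slack linearN /= trmxK opprK.
by rewrite -mx11_scalar vsubmxK.
Qed.

Lemma exists_kernel m n (W : 'M[R]_(m, n)) : (\rank W < n)%N ->
  exists2 c : 'cV[R]_n, c != 0 & W *m c = 0.
Proof.
move=> Wn; have : kermx W^T != 0.
  by rewrite -mxrank_eq0 mxrank_ker mxrank_tr -lt0n subn_gt0.
case/rowV0Pn => z /sub_kermxP zW z0; exists z^T.
  by rewrite trmx_eq0.
by apply: trmx_inj; rewrite trmx_mul trmxK zW trmx0.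
Qed.

(** The functional [c] kills the rows of [M] but not [w], so [w] is independent of
    them. *)
Lemma row_free_col_mx n (w : 'rV[R]_(1 + d)) (M : 'M[R]_(n, 1 + d)) (c : 'cV[R]_(1 + d)) :
  row_free M -> M *m c = 0 -> w *m c != 0 -> row_free (col_mx w M).
Proof.
move=> fM Mc wc; rewrite -kermx_eq0; apply/eqP/row_matrixP => i; rewrite row0.
have := row_sub i (kermx (col_mx w M)); move: (row i _) => z /sub_kermxP.
rewrite -[z]hsubmxK mul_row_col => zM.
have := congr1 (mulmx^~ c) zM; rewrite mulmxDl mul0mx -!mulmxA Mc mulmx0 addr0.
rewrite {1}[lsubmx z]mx11_scalar mul_scalar_mx => /eqP.
rewrite scaler_eq0 (negPf wc) orbF => /eqP z0.
have l0 : lsubmx z = 0 by rewrite [LHS]mx11_scalar z0 raddf0.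
move: zM; rewrite l0 mul0mx add0r => zM.
have -> : rsubmx z = 0 by apply: (row_free_inj fM); rewrite /= zM mul0mx.
by rewrite row_mx0.
Qed.

Definition fulldim (I : finType) (v : I -> 'rV[R]_d) :=
  forall u b, (forall i, dot (v i) u = b) -> u = 0.

Lemma homog_cons r (w : 'I_r -> 'rV[R]_d) p :
  homog (fun k : 'I_r.+1 => if unlift ord0 k is Some k' then w k' else p) =
  col_mx (hat p) (homog w).
Proof.
apply/row_matrixP => i; rewrite rowK; case: (@split_ordP 1 r i) => k ->.
  rewrite (@rowKu _ 1 r) (_ : lshift r k = ord0); last by apply/val_inj; rewrite ord1.
  by rewrite unlift_none ord1 row_id.
rewrite (@rowKd _ 1 r) (_ : rshift 1 k = lift ord0 k); last exact/val_inj.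
by rewrite liftK rowK.
Qed.

Section Family.
Variables (I : finType) (v : I -> 'rV[R]_d).
Hypothesis fullv : fulldim v.

(** As long as the tight points together with [x] span less than the whole space,
    some affine functional [(u', b')] vanishes on all of them. Rotate the
    hyperplane by adding multiples of it until it first hits a new point [v j];
    this neither changes the strict separation of [x] nor loses a tight point,
    and [v j] is independent of the previous ones since [(u', b')] does not vanish
    there. *)
Lemma separating_facet_step x r u b (f : 'I_r -> I) : (r < d)%N ->
  (forall i, dot (v i) u <= b) -> b < dot x u -> (forall k, dot (v (f k)) u = b) ->
  row_free (homog (v \o f)) ->
  exists u b (f : 'I_r.+1 -> I),
    [/\ forall i, dot (v i) u <= b, b < dot x u,
        forall k, dot (v (f k)) u = b & row_free (homog (v \o f))].
Proof.
move=> rd vu bx fu ff.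
have [|c c0 Wc] := @exists_kernel r.+1 (1 + d) (col_mx (hat x) (homog (v \o f)) :
  'M[R]_(1 + r, 1 + d)).
  by apply: leq_ltn_trans (rank_leq_row _) _; rewrite ltnS.
have [u' [b' cE]] := slack_surj c; rewrite {}cE in c0 Wc.
move: Wc; rewrite (@mul_col_mx _ 1 r) hat_slack homog_slack => /eqP.
rewrite (@col_mx_eq0 _ 1 r) => /andP[/eqP/matrixP/(_ 0 0)]; rewrite !mxE mulr1n => /eqP.
rewrite subr_eq0 => /eqP xb' /eqP/colP fb'.
have {}fb' k : dot (v (f k)) u' = b'.
  by have := fb' k; rewrite !mxE => /eqP; rewrite subr_eq0 => /eqP.
have u'0 : u' != 0.
  apply: contraNneq c0 => u'0; move: xb'; rewrite u'0 dot0r /slack => ->.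
  by rewrite trmx0 oppr0 raddf0 col_mx0.
wlog [i0 hi0] : u' b' c0 xb' fb' u'0 / exists i, b' < dot (v i) u'.
  move=> wl; have [i ib'] : exists i, dot (v i) u' != b'.
    apply/existsP; rewrite -negb_forall; apply: contraNN u'0 => /forallP h.
    by apply/eqP; apply: (@fullv u' b') => i; apply/eqP; have := h i.
  move: ib'; rewrite neq_lt => /orP[lt|gt]; last by apply: (wl u' b') => //; exists i.
  apply: (wl (- u') (- b')).
  - by rewrite slackN oppr_eq0.
  - by rewrite dotNr xb'.
  - by move=> k; rewrite dotNr fb'.
  - by rewrite oppr_eq0.
  - by exists i; rewrite dotNr ltrN2.
(* [q i] is the amount of rotation at which [v i] becomes tight. *)
pose q i := (b - dot (v i) u) / (dot (v i) u' - b').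
case: (arg_minP (P := fun i => b' < dot (v i) u') q hi0) => j jP jmin.
set s := q j in jmin.
have s0 : 0 <= s by rewrite divr_ge0// subr_ge0// ltW.
have jE : dot (v j) (u + s *: u') = b + s * b'.
  have h : dot (v j) u' - b' != 0 by rewrite subr_eq0 gt_eqF.
  have : s * (dot (v j) u' - b') = b - dot (v j) u by rewrite /s /q divfK.
  by rewrite dotDr dotZr => ?; lra.
exists (u + s *: u'), (b + s * b'), (fun k => if unlift ord0 k is Some k' then f k' else j).
split.
- move=> i; rewrite dotDr dotZr.
  have [h|h] := ltP b' (dot (v i) u'); last first.
    by rewrite lerD// ler_wpM2l.
  have := jmin i h; rewrite /q ler_pdivlMr ?subr_gt0// => ?; lra.
- by rewrite dotDr dotZr -xb' ltrD2r.
- by move=> k; case: unliftP => [k'|] _ //; rewrite dotDr dotZr fb' fu.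
- have -> : homog (v \o (fun k => if unlift ord0 k is Some k' then f k' else j)) = col_mx
  (hat (v j)) (homog (v \o f)).
    rewrite -homog_cons; apply/row_matrixP => k; rewrite !rowK /=.
    by case: unliftP.
  apply: (row_free_col_mx (c := slack u' b')) => //.
    by rewrite homog_slack; apply/colP => k; rewrite !mxE /= fb' subrr.
  rewrite hat_slack; apply/eqP => /matrixP/(_ 0 0); rewrite !mxE mulr1n => /eqP.
  by rewrite subr_eq0 lt_eqF.
Qed.

(** Farkas' lemma in homogeneous coordinates: the first coordinate of a conic
    combination is its total weight, which must then be 1. *)
Lemma separating_hyperplane x : ~ hull v [set: I]%SET x ->
  exists u b, (forall i, dot (v i) u <= b) /\ b < dot x u.
Proof.
move=> xP; case: (farkas [seq hat (v i) | i <- enum I] (hat x)).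
  case/(@cone_sum _ _ _ (fun i => hat (v i)) _ _ (enum_uniq _)) => w w0 [_ E]; exfalso; apply: xP.
  have := congr1 lsubmx E; have := congr1 rsubmx E.
  rewrite row_mxKl row_mxKr !linear_sum /= => -> /matrixP/(_ 0 0).
  rewrite summxE !mxE => E1.
  exists w; split => //.
  - by move=> i; rewrite inE.
  - rewrite [RHS]E1; apply: eq_bigr => i _.
    by rewrite linearZ /= row_mxKl !mxE mulr1.
  - by apply: eq_bigr => i _; rewrite linearZ /= row_mxKr.
case=> c [c0 cx]; have [u [b cE]] := slack_surj c^T.
have D y : dot (hat y) c = b - dot y u.
  by rewrite dotE cE hat_slack !mxE mulr1n.
exists u, b; split; last by rewrite -subr_lt0 -D.
by move=> i; rewrite -subr_ge0 -D; apply: c0; apply: map_f; rewrite mem_enum.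
Qed.

Lemma separating_facet x : ~ hull v [set: I]%SET x ->
  exists u b (f : 'I_d -> I),
    [/\ forall i, dot (v i) u <= b, b < dot x u,
        forall k, dot (v (f k)) u = b & row_free (homog (v \o f))].
Proof.
move=> /separating_hyperplane[u [b [vu bx]]].
suff : forall r, (r <= d)%N -> exists u b (f : 'I_r -> I),
    [/\ forall i, dot (v i) u <= b, b < dot x u,
        forall k, dot (v (f k)) u = b & row_free (homog (v \o f))] by apply.
elim=> [_|r IH rd].
  exists u, b, (fun k : 'I_0 => False_rect _ (notF (ltn_ord k))); split=> //; first by case.
  by rewrite -row_leq_rank.
have [u1 [b1 [f1 [? ? ? ?]]]] := IH (ltnW rd).
exact: (@separating_facet_step x r u1 b1 f1).
Qed.

End Family.
End Facets.

(** * Facets as sets of vertices *)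

Section FacetData.
Context {R : realType} {d : nat}.
Implicit Types (x u p : 'rV[R]_d) (b : R).

Section AffineBasis.
Variables (w : 'I_d -> 'rV[R]_d) (u : 'rV[R]_d) (b : R).
Hypotheses (fw : row_free (homog w)) (wu : forall k, dot (w k) u = b).

Lemma homog_slack0 : homog w *m slack u b = 0.
Proof. by rewrite homog_slack; apply/colP => k; rewrite !mxE wu subrr. Qed.

(** Adding a point off the hyperplane to [d] affinely independent points on it
    gives an affine basis, in which [facet_normal_unique] and [facet_span] compute. *)
Lemma apex_unit p : dot p u != b ->
  (col_mx (hat p) (homog w) : 'M[R]_(1 + d)) \in unitmx.
Proof.
move=> pu; rewrite -row_free_unit; apply: (row_free_col_mx (c := slack u b)) => //.
  exact: homog_slack0.
rewrite hat_slack; apply/eqP => /matrixP/(_ 0 0); rewrite !mxE mulr1n => /eqP.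
by rewrite subr_eq0 eq_sym (negPf pu).
Qed.

Hypothesis u0 : u != 0.

Lemma exists_apex : exists p, dot p u != b.
Proof.
have [h|h] := eqVneq 0 b; last by exists 0; rewrite dot0l.
by exists u; rewrite -h dot_eq0.
Qed.

Lemma facet_normal_unique u' b' : (forall k, dot (w k) u' = b') ->
  exists t, u' = t *: u /\ b' = t * b.
Proof.
move=> wu'; have [p pu] := exists_apex; have uN := apex_unit pu.
set N := col_mx _ _ in uN.
have bp : b - dot p u != 0 by rewrite subr_eq0 eq_sym.
pose t := (b' - dot p u') / (b - dot p u).
have E : slack u' b' = t *: slack u b.
  apply: (can_inj (mulKmx uN)); rewrite -scalemxAr !mul_col_mx !hat_slack homog_slack0.
  rewrite (_ : homog w *m slack u' b' = 0); last first.
    by rewrite homog_slack; apply/colP => k; rewrite !mxE wu' subrr.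
  by rewrite scale_col_mx scaler0 scale_scalar_mx /t divfK.
exists t; move: E; rewrite /slack scale_col_mx => /eq_col_mx[E1 E2]; split.
  by apply: trmx_inj; apply: oppr_inj; rewrite E2 linearZ /= scalerN.
by move/matrixP/(_ 0 0): E1; rewrite !mxE !mulr1n.
Qed.

Lemma facet_span x : dot x u = b -> exists z : 'rV[R]_d, hat x = z *m homog w.
Proof.
move=> xu; have [p pu] := exists_apex; have uN := apex_unit pu.
set N := col_mx _ _ in uN.
pose y : 'rV[R]_(1 + d) := hat x *m invmx N.
have yN : y *m N = hat x by rewrite mulmxKV.
exists (rsubmx y); have := congr1 (mulmx^~ (slack u b)) yN.
rewrite -{1}[y]hsubmxK mul_row_col mulmxDl -!mulmxA !hat_slack homog_slack0 mulmx0 addr0 xu subrr.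
rewrite mul_mx_scalar raddf0 => /eqP; rewrite scaler_eq0 subr_eq0 eq_sym (negPf pu) /= => /eqP y0.
by rewrite -yN -[y in LHS]hsubmxK mul_row_col y0 mul0mx add0r.
Qed.

End AffineBasis.

Section Family.
Variables (I : finType) (v : I -> 'rV[R]_d).
Implicit Types J K : {set I}.

Definition supports J u b := [/\ dot u u = 1, forall i, dot (v i) u <= b &
  forall i, (i \in J) = (dot (v i) u == b)].

(** [J] is the set of vertices on a supporting hyperplane with unit normal [u], and
    [f] picks [d] affinely independent ones among them: the combinatorial data of
    a facet, with a witness of its dimension. *)
Definition facial J u b (f : 'I_d -> I) :=
  [/\ supports J u b, forall k, f k \in J & row_free (homog (v \o f))].

Lemma supports_neq0 J u b : supports J u b -> u != 0.
Proof. by case=> h _ _; rewrite -dot_eq0 h oner_eq0. Qed.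

Lemma facial_tight J u b f : facial J u b f -> forall k, dot (v (f k)) u = b.
Proof. by case=> -[_ _ h] fJ _ k; apply/eqP; rewrite -h. Qed.

Lemma hull_le u b : (forall i, dot (v i) u <= b) -> forall x J, hull v J x -> dot x u <= b.
Proof.
move=> vb x J [w [w0 _ w1 ->]]; rewrite dot_suml -[b]mul1r -w1 mulr_suml.
by apply: ler_sum => i _; rewrite dotZl ler_wpM2l.
Qed.

Lemma subset_hull J K : J \subset K -> hull v J `<=` hull v K.
Proof.
move=> JK x [w [w0 wJ w1 ->]]; exists w; split=> // i iK; apply: wJ.
apply: contraNN iK. exact: (fintype.subsetP JK).
Qed.

Lemma hull_vertex J i : i \in J -> hull v J (v i).
Proof.
move=> iJ; exists (fun j => (j == i)%:R); split.
- by move=> j; rewrite ler0n.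
- by move=> j jJ; case: eqP => // ji; move: jJ; rewrite ji iJ.
- by rewrite (bigD1 i)//= eqxx big1 ?addr0// => j /negPf ->.
- by rewrite (bigD1 i)//= eqxx scale1r big1 ?addr0// => j /negPf ->; rewrite scale0r.
Qed.

(** In a convex combination on a supporting hyperplane, points off the hyperplane
    must have weight 0. *)
Lemma hull_tight J u b : (forall i, dot (v i) u <= b) ->
  (forall i, (i \in J) = (dot (v i) u == b)) ->
  hull v [set: I]%SET `&` [set x | dot x u = b] = hull v J.
Proof.
move=> vb Jb; apply/seteqP; split=> x.
  case=> -[w [w0 _ w1 ->]] /= xb; exists w; split=> // i; rewrite Jb => ib.
  have : \sum_i w i * (b - dot (v i) u) = 0.
    under eq_bigr do rewrite mulrBr.
    rewrite sumrB -mulr_suml w1 mul1r -xb dot_suml; apply/eqP; rewrite subr_eq0; apply/eqP.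
    by apply: eq_bigr => j _; rewrite dotZl.
  move/eqP; rewrite psumr_eq0; last by move=> j _; rewrite mulr_ge0// subr_ge0.
  move/allP/(_ i (mem_index_enum _)) => /=;
    rewrite mulf_eq0 subr_eq0 [b == _]eq_sym (negPf ib) orbF.
  by move/eqP.
move=> xJ; split; first by apply: subset_hull xJ; exact: finset.subsetT.
case: xJ => w [w0 wJ w1 ->] /=; rewrite dot_suml -[RHS]mul1r -w1 mulr_suml.
apply: eq_bigr => i _; rewrite dotZl; have [iJ|/wJ ->] := boolP (i \in J).
  by move: iJ; rewrite Jb => /eqP ->.
by rewrite !mul0r.
Qed.

Lemma supports_hull_inj J u b K : supports J u b -> hull v K = hull v J -> K \subset J.
Proof.
move=> [_ vb Jb] KJ; apply/fintype.subsetP => i iK.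
have : hull v J (v i) by rewrite -KJ; exact: hull_vertex.
by rewrite -(hull_tight vb Jb) => -[_ /= h]; rewrite Jb h.
Qed.

Hypothesis fullv : fulldim v.

Lemma supports_strict J u b : supports J u b -> exists i, dot (v i) u < b.
Proof.
move=> S; have := supports_neq0 S; case: S => _ vb _ u0.
apply/existsP; apply: contraNT u0; rewrite negb_exists => /forallP h.
apply/eqP/(@fullv u b) => i; apply/eqP; rewrite eq_le vb /= leNgt; exact: h.
Qed.

(** The normal is determined up to a factor by the [d] affinely independent
    points; the factor has absolute value 1 because both normals are unit vectors,
    and it is nonnegative because some vertex lies strictly on the negative side
    of the first hyperplane and not on the positive side of the second. *)
Lemma facial_unique J u b f u' b' : facial J u b f -> supports J u' b' -> u' = u /\ b' = b.
Proof.
move=> F S'; have [S fJ ff] := F.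
have [|t [uE bE]] := facet_normal_unique ff (facial_tight F) (supports_neq0 S) (u' := u')
  (b' := b').
  by move=> k; apply/eqP; rewrite /=; case: S' => _ _ <-.
have [i ib] := supports_strict S.
have [n1 vb _] := S; have [n1' vb' _] := S'.
have t0 : 0 <= t.
  have := vb' i; rewrite uE bE dotZr => h.
  have : 0 <= t * (b - dot (v i) u) by lra.
  by rewrite pmulr_lge0// subr_gt0.
have t1 : t = 1.
  move: n1'; rewrite uE dotZl dotZr n1 mulr1 => /eqP.
  by rewrite -expr2 sqrf_eq1 => /orP[/eqP//|/eqP h]; move: t0; rewrite h; lra.
by rewrite uE bE t1 scale1r mul1r.
Qed.

Lemma facial_of_tight u b (f : 'I_d -> I) : u != 0 ->
  (forall i, dot (v i) u <= b) -> (forall k, dot (v (f k)) u = b) ->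
  row_free (homog (v \o f)) ->
  exists2 r, 0 < r & facial [set i | dot (v i) u == b]%SET (r *: u) (r * b) f.
Proof.
move=> u0 vb fb ff.
have n0 : 0 < dot u u by rewrite lt_neqAle eq_sym dot_eq0 u0 dot_ge0.
have r0 : 0 < (Num.sqrt (dot u u))^-1 by rewrite invr_gt0 sqrtr_gt0.
exists (Num.sqrt (dot u u))^-1 => //; split=> //; last by move=> k; rewrite inE fb.
split.
- by rewrite dotZl dotZr mulrA -expr2 exprVn sqr_sqrtr ?ltW// mulVf// gt_eqF.
- by move=> i; rewrite dotZr ler_pM2l.
- by move=> i; rewrite inE dotZr (inj_eq (mulfI _))// gt_eqF.
Qed.

Lemma separating_facial x : (0 < d)%N -> ~ hull v [set: I]%SET x ->
  exists J u b f, facial J u b f /\ b < dot x u.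
Proof.
move=> d0 /(separating_facet fullv)[u [b [f [vb bx fb ff]]]].
have u0 : u != 0.
  apply: contraTneq bx => u0; have := fb (Ordinal d0); rewrite u0 !dot0r => <-.
  by rewrite ltxx.
have [r r0 F] := facial_of_tight u0 vb fb ff.
by exists [set i | dot (v i) u == b]%SET, (r *: u), (r * b), f; rewrite dotZr ltr_pM2l.
Qed.

End Family.
End FacetData.

(** * Lattice polytopes as hulls of lattice points *)

Section Lattice.
Context {R : realType} {d : nat}.
Implicit Types (x u p : 'rV[R]_d) (b : R).

Lemma hull_val (I : finType) (v : I -> 'rV[R]_d) (J : {set I}) :
  hull (fun i : {i | i \in J} => v (val i)) [set: {i | i \in J}]%SET = hull v J.
Proof.
rewrite -!conv_hullE; congr conv_hull; apply/seteqP; split=> x /=.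
  by case=> -[i iJ] _ <-; exists i.
by case=> i iJ <-; exists (exist _ i iJ) => //=; rewrite inE.
Qed.

(** A hyperplane separating [v i] from the hull of the other points, moved to pass
    through [v i], supports the polytope at [v i] only. *)
Lemma vertex_minimal (I : finType) (v : I -> 'rV[R]_d) (J : {set I}) i :
  i \in J -> ~ hull v (J :\ i)%SET (v i) -> vertex (hull v J) (v i).
Proof.
move=> iJ; rewrite -(hull_val v (J :\ i)%SET) => /separating_hyperplane[u [b [vb bi]]].
pose v' (j : {j | j \in J}) := v (val j).
have lt j : j \in J -> j != i -> dot (v j) u < dot (v i) u.
  move=> jJ ji; have jJi : j \in (J :\ i)%SET by rewrite !inE ji.
  by apply: le_lt_trans bi; exact: (vb (exist _ j jJi)).
have le (j : {j | j \in J}) : dot (v' j) u <= dot (v i) u.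
  rewrite /v'; have [->//|ji] := eqVneq (val j) i.
  by rewrite ltW// lt// (valP j).
exists u, (dot (v i) u).
rewrite -hull_val; split; first by move=> x; apply: hull_le.
rewrite (@hull_tight _ _ _ v' [set exist _ i iJ]%SET) //.
  apply/seteqP; split=> x /=.
    move=> ->; have -> : v i = v' (exist _ i iJ) by [].
    by apply: hull_vertex; rewrite inE.
  case=> w [w0 wJ w1 ->].
  have w0' j : j != exist _ i iJ -> w j = 0 by move=> ji; apply: wJ; rewrite inE.
  rewrite (bigD1 (exist _ i iJ))//= big1; last by move=> j /w0' ->; rewrite scale0r.
  move: w1; rewrite (bigD1 (exist _ i iJ))//= big1; last by move=> j /w0' ->.
  by rewrite !addr0 => ->; rewrite scale1r.
case=> j jJ; rewrite inE -val_eqE /v' /=; have [->|ji] := eqVneq j i; first by rewrite eqxx.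
by apply/esym/negbTE; rewrite neq_lt lt.
Qed.

(** In a minimal generating set every point is a vertex, hence a lattice point. *)
Lemma lattice_hull (P : set 'rV[R]_d) : lattice_polytope P ->
  exists (I : finType) (v : I -> 'rV[R]_d),
    P = hull v [set: I]%SET /\ forall i j, v i 0 j \is a Num.int.
Proof.
case=> -[A /finite_seqP[s ->] PE] Pint.
pose v (i : 'I_(size s)) := nth 0 s i.
have PT : hull v [set: 'I_(size s)]%SET = P.
  rewrite PE -conv_hullE; congr conv_hull; apply/seteqP; split=> x /=.
    by case=> i _ <-; exact: mem_nth.
  move=> xs; have xi : (index x s < size s)%N by rewrite index_mem.
  by exists (Ordinal xi); rewrite ?inE// /v nth_index.
have [|J /minsetP[/asboolP JP Jmin]] := @ex_minset _ (fun J => `[< hull v J = P >]).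
  by exists [set: 'I_(size s)]%SET; apply/asboolP.
exists {i | i \in J}, (fun i => v (val i)); rewrite hull_val; split=> // -[i iJ] /=.
apply: Pint; rewrite -JP; apply: vertex_minimal => // vi.
suff : (J :\ i)%SET = J by move/setP/(_ i); rewrite !inE eqxx iJ.
apply: Jmin; last exact: subD1set.
apply/asboolP; rewrite -JP; apply/seteqP; split; first exact/subset_hull/subD1set.
case: vi => w [w0 wJ w1 viE] x [z [z0 zJ z1 ->]].
(* Substitute the combination of the other points for [v i] in that of [x]. *)
exists (fun j => (if j == i then 0 else z j) + z i * w j); split.
- by move=> j; rewrite addr_ge0// ?mulr_ge0//; case: eqP.
- move=> j; rewrite !inE negb_and negbK => /orP[/eqP ->|jJ].
    by rewrite eqxx wJ ?mulr0 ?addr0// !inE eqxx.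
  by rewrite zJ// wJ ?mulr0 ?addr0 ?if_same// !inE (negPf jJ) andbF.
- rewrite big_split /= -mulr_sumr w1 mulr1 -z1 (bigD1 i)//= eqxx add0r [RHS](bigD1 i)//= addrC.
  by congr (_ + _); apply: eq_bigr => j /negPf ->.
under [RHS]eq_bigr do rewrite scalerDl -scalerA.
rewrite big_split /= -scaler_sumr -viE [in RHS](bigD1 i)//= eqxx scale0r add0r.
rewrite (bigD1 i)//= addrC; congr (_ + _); apply: eq_bigr => j /negPf -> //.
Qed.

End Lattice.

(** * Dimension of polytopes and of their facets *)

Section Dimension.
Context {R : realType} {d : nat}.
Implicit Types (x u p : 'rV[R]_d) (b : R).

Lemma mem_aff_hull (A : set 'rV[R]_d) x : A x -> aff_hull A x.
Proof.
move=> Ax; exists 1, (fun=> x), (fun=> 1).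
by rewrite !big_ord1 scale1r.
Qed.

Lemma aff_hull_dot (A : set 'rV[R]_d) u b : (forall x, A x -> dot x u = b) ->
  forall x, aff_hull A x -> dot x u = b.
Proof.
move=> Ab x [n [y [w [Ay w1 ->]]]]; rewrite dot_suml -[b]mul1r -w1 mulr_suml.
by apply: eq_bigr => i _; rewrite dotZl Ab.
Qed.

Lemma aff_hull_neq0 (A : set 'rV[R]_d) x : aff_hull A x -> exists y, A y.
Proof.
case=> -[|n] [y [w [Ay w1 _]]]; last by exists (y ord0).
by move: w1; rewrite big_ord0 => /eqP; rewrite eq_sym oner_eq0.
Qed.

Lemma exists_orthogonal (V : {vspace 'rV[R]_d}) : (\dim V < d)%N ->
  exists2 u, u != 0 & forall y, y \in V -> dot y u = 0.
Proof.
move=> Vd; pose W := \matrix_(k < \dim V) ((vbasis V)`_k : 'rV[R]_d).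
have [c c0 Wc] := exists_kernel (leq_ltn_trans (rank_leq_row W) Vd); exists c^T;
  first by rewrite trmx_eq0.
move=> y /coord_vbasis ->; rewrite dot_suml big1// => k _; rewrite dotZl dotE trmxK.
have := congr1 (row k) Wc; rewrite row_mul rowK => ->.
by rewrite !mxE mulr0.
Qed.

Lemma has_dim_full (A : set 'rV[R]_d) u b : has_dim A d ->
  (forall x, A x -> dot x u = b) -> u = 0.
Proof.
case=> x0 [V [AV Vd]] /aff_hull_dot Ab.
have VT : V = fullv.
  by apply/eqP; rewrite eqEdim subvf dimvf /dim /= mul1n Vd /=.
have aT x : aff_hull A x by rewrite AV /= VT memvf.
have b0 : b = 0 by rewrite -(Ab 0 (aT _)) dot0l.
by apply/eqP; rewrite -dot_eq0 (Ab _ (aT _)) b0.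
Qed.

Lemma hat_sum (I : finType) (w : I -> R) (y : I -> 'rV[R]_d) : \sum_i w i = 1 ->
  hat (\sum_i w i *: y i) = \sum_i w i *: hat (y i).
Proof.
move=> w1; apply/rowP => j; rewrite summxE /hat.
case: (split_ordP j) => k ->.
  rewrite row_mxEl mxE ord1 -[LHS]/(1 : R) -[LHS]w1.
  by apply: eq_bigr => i _; rewrite [RHS]mxE row_mxEl mxE eqxx mulr1n mulr1.
rewrite row_mxEr summxE.
by apply: eq_bigr => i _; rewrite [RHS]mxE row_mxEr mxE.
Qed.

Section Family.
Variables (I : finType) (v : I -> 'rV[R]_d).
Implicit Types J : {set I}.

Lemma fulldim_hull : has_dim (hull v [set: I]%SET) d -> fulldim v.
Proof.
move=> dP u b vb; apply: (@has_dim_full _ u b dP) => x [w [_ _ w1 ->]].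
rewrite dot_suml -[b]mul1r -w1 mulr_suml.
by apply: eq_bigr => i _; rewrite dotZl vb.
Qed.

Lemma dim_orthogonal u : u != 0 ->
  exists2 V : {vspace 'rV[R]_d}, (forall y, (y \in V) = (dot y u == 0)) & \dim V = d.-1.
Proof.
move=> u0; pose g := linfun (mulmxr u^T : 'rV[R]_d -> 'rV[R]_1).
have gE y : g y = (dot y u)%:M by rewrite lfunE /= dotE -mx11_scalar.
have g0 y : (g y == 0) = (dot y u == 0).
  rewrite gE; apply/eqP/eqP => [/matrixP/(_ 0 0)|->]; last by rewrite raddf0.
  by rewrite !mxE mulr1n.
exists (lker g); first by move=> y; rewrite memv_ker g0.
have := limg_ker_dim g fullv; rewrite capfv dimvf /dim /= mul1n => h.
suff e1 : \dim (limg g) = 1%N by rewrite -[RHS]/(d.-1) -(congr1 predn h) e1 addn1.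
apply/eqP; rewrite eqn_leq; apply/andP; split.
  by apply: leq_trans (dimvS (subvf _)) _; rewrite dimvf /dim /=.
rewrite lt0n dimv_eq0; apply: contraNneq u0 => g00.
rewrite -dot_eq0 -g0 -memv0 -g00; apply: memv_img; exact: memvf.
Qed.

(** The [d] affinely independent points span the whole hyperplane. *)
Lemma has_dim_facial J u b f : (0 < d)%N -> facial v J u b f -> has_dim (hull v J) d.-1.
Proof.
move=> d0 F; have u0 : u != 0 by case: F => /supports_neq0.
have [V VE Vd] := dim_orthogonal u0; have fb := facial_tight F.
case: F => -[_ vb Jb] fJ ff.
exists (v (f (Ordinal d0))), V; split=> //.
apply/seteqP; split=> x /=.
  move=> xa; rewrite VE dotDl dotNl fb subr_eq0; apply/eqP.
  by apply: (aff_hull_dot _ xa) => y; rewrite -(hull_tight vb Jb) => -[].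
rewrite VE dotDl dotNl fb subr_eq0 => /eqP xu.
have [z zE] := @facet_span R d (v \o f) u b ff fb u0 x xu.
exists d, (v \o f), (fun k => z 0 k); split=> [k||].
- exact: hull_vertex.
- have := congr1 lsubmx zE; rewrite row_mxKl => /matrixP/(_ 0 0).
  rewrite !mxE eqxx mulr1n => E; rewrite [RHS]E; apply: eq_bigr => k _.
  by rewrite [homog _ _ _]mxE row_mxEl mxE eqxx mulr1n mulr1.
- have := congr1 rsubmx zE; rewrite row_mxKr => ->.
  apply/rowP => j; rewrite [LHS]mxE [LHS]mxE summxE; apply: eq_bigr => k _.
  by rewrite [RHS]mxE [homog _ _ _]mxE row_mxEr.
Qed.

Lemma row_free_pick m n (T : 'M[R]_(m, n)) r : r = \rank T ->
  exists f : 'I_r -> 'I_m, row_free (rowsub f T).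
Proof. by move=> ->; exists (maxrankfun T); exact: maxrowsub_free. Qed.

(** In homogeneous coordinates, [x0] and the directions in [V] are [1 + dim V]
    independent vectors, and all of them are combinations of the points in [J]. *)
Lemma dim_lt_rank J (T := homog (fun k : 'I_#|J| => v (enum_val k))) x0 (V : {vspace 'rV[R]_d}) :
  aff_hull (hull v J) = [set x | x - x0 \in V] -> (\dim V < \rank T)%N.
Proof.
move=> aE.
have hT x : aff_hull (hull v J) x -> (hat x <= T)%MS.
  have hJ y : hull v J y -> (hat y <= T)%MS.
    case=> w [_ wJ w1 ->]; rewrite hat_sum//.
    apply: summx_sub => i _; have [iJ|/wJ ->] := boolP (i \in J); last by rewrite scale0r sub0mx.
    apply: scalemx_sub; rewrite -[i](enum_rankK_in iJ iJ).
    by have := row_sub (enum_rank_in iJ i) T; rewrite rowK.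
  case=> n [y [w [yJ w1 ->]]]; rewrite hat_sum//.
  by apply: summx_sub => i _; apply/scalemx_sub/hJ.
have x0a : aff_hull (hull v J) x0 by rewrite aE /= subrr mem0v.
pose B := \matrix_(k < \dim V) (row_mx 0 (vbasis V)`_k : 'rV[R]_(1 + d)).
have fB : row_free B.
  rewrite -kermx_eq0; apply/eqP/row_matrixP => i; rewrite row0.
  have := row_sub i (kermx B); move: (row i _) => z /sub_kermxP zB.
  have : \sum_k z 0 k *: (vbasis V)`_k = 0.
    have := congr1 rsubmx zB; rewrite mulmx_sum_row !linear_sum /= linear0 => zB'.
    rewrite -[RHS]zB'; apply: eq_bigr => k _.
    by rewrite linearZ /= rowK row_mxKr.
  have /freeP fV := basis_free (vbasisP V).
  by move=> /(fV (fun k => z 0 k)) z0; apply/rowP => k; rewrite z0 mxE.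
pose c : 'cV[R]_(1 + d) := col_mx 1%:M 0.
have Bc : B *m c = 0.
  by apply/row_matrixP => k; rewrite row_mul rowK mul_row_col mulmx0 mul0mx addr0 row0.
have xc : hat x0 *m c != 0.
  rewrite mul_row_col mulmx0 addr0 mulmx1; apply/eqP => /matrixP/(_ 0 0)/eqP.
  by rewrite !mxE oner_eq0.
have := row_free_col_mx fB Bc xc; rewrite /row_free => /eqP e.
rewrite -[X in (X <= _)%N]e.
apply: mxrankS; rewrite col_mx_sub hT //=; apply/row_subP => k; rewrite rowK.
have -> : row_mx 0 (vbasis V)`_k = hat (x0 + (vbasis V)`_k) - hat x0.
  by rewrite /hat opp_row_mx add_row_mx subrr addrAC subrr add0r.
rewrite addmx_sub// ?eqmx_opp ?hT//.
by rewrite aE /= addrAC subrr add0r vbasis_mem// mem_nth// size_tuple.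
Qed.

Hypothesis fullv : fulldim v.

(** The supporting functional cannot be 0, since then the face would be the whole
    polytope, whose dimension is too large. The tight points have rank at least
    [d] by [dim_lt_rank], and at most [d] since they lie on a hyperplane. *)
Lemma facet_facial F : (0 < d)%N -> facets (hull v [set: I]%SET) F ->
  exists J u b f, facial v J u b f /\ F = hull v J.
Proof.
move=> d0 [[a [c [vc FE]]] [x0 [V [aE Vd]]]].
pose J := [set i | dot (v i) a == c]%SET.
have va i : dot (v i) a <= c by apply: vc; apply: hull_vertex; rewrite inE.
have FJ : F = hull v J by rewrite FE (hull_tight (J := J))// => i; rewrite inE.
have [y Fy] : exists y, F y by apply: (@aff_hull_neq0 _ x0); rewrite aE /= subrr mem0v.
have a0 : a != 0.
  apply/eqP => a0; have c0 : c = 0.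
    by move: Fy; rewrite FE a0 => -[_ /=]; rewrite dot0r => ->.
  have [|u u0 uV] := @exists_orthogonal V; first by rewrite Vd prednK.
  move/eqP: u0; apply; apply: (@fullv u (dot x0 u)) => i.
  have : aff_hull F (v i).
    apply: mem_aff_hull; rewrite FE a0 c0; split; last by rewrite /= dot0r.
    by apply: hull_vertex; rewrite inE.
  by rewrite aE /= => /uV /eqP; rewrite dotDl dotNl subr_eq0 => /eqP.
have rk : d = \rank (homog (fun k : 'I_#|J| => v (enum_val k))).
  apply/eqP; rewrite eqn_leq; apply/andP; split.
    rewrite FJ in aE; have := @dim_lt_rank J x0 V aE.
    by rewrite Vd prednK.
  have : (homog (fun k : 'I_#|J| => v (enum_val k))) *m slack a c = 0.
    rewrite homog_slack; apply/colP => k; rewrite !mxE.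
    by have := enum_valP k; rewrite inE => /eqP ->; rewrite subrr.
  set T := homog _ => Tn; rewrite leqNgt; apply/negP => rT.
  have uT : row_full T by rewrite /row_full eqn_leq rank_leq_col.
  have : slack a c = 0.
    by apply: (row_full_inj uT); rewrite Tn mulmx0.
  move/(congr1 dsubmx); rewrite col_mxKd linear0 => /eqP.
  by rewrite oppr_eq0 trmx_eq0 (negPf a0).
have [g fg] := row_free_pick rk.
pose f k := enum_val (g k) : I.
have [||r r0 F'] := @facial_of_tight _ _ _ v a c f a0 va.
- by move=> k; have := enum_valP (g k); rewrite inE => /eqP.
- move: fg; congr row_free; apply/row_matrixP => k; rewrite rowK row_rowsub.
  by rewrite rowK.
by exists J, (r *: a), (r * c), f; rewrite FJ; split.
Qed.

End Family.
End Dimension.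

(** * Isometric parametrizations of facets *)

Section Parametrization.
Context {R : realType} {k : nat}.
Local Notation d := k.+1.
Implicit Types (x u p : 'rV[R]_d) (b : R) (U : 'M[R]_(k, d)).

Lemma mulmx_dot n (x u : 'rV[R]_n) : x *m u^T = (dot x u)%:M.
Proof. by rewrite dotE -mx11_scalar. Qed.

Definition reflection n (w : 'rV[R]_n) : 'M[R]_n := 1%:M - (2 / dot w w) *: (w^T *m w).

Lemma reflection_sym n (w : 'rV[R]_n) : (reflection w)^T = reflection w.
Proof. by rewrite /reflection linearB /= trmx1 linearZ /= trmx_mul trmxK. Qed.

Lemma reflectionK n (w : 'rV[R]_n) : reflection w *m reflection w = 1%:M.
Proof.
rewrite /reflection; set c := 2 / _; set A := w^T *m w.
have AA : A *m A = dot w w *: A.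
  by rewrite /A mulmxA -(mulmxA w^T) mulmx_dot mul_mx_scalar -scalemxAl.
rewrite mulmxBl mul1mx mulmxBr mulmx1 -scalemxAl -scalemxAr AA.
suff : c *: (c *: (dot w w *: A)) = c *: A + c *: A.
  by move=> ->; rewrite opprB addrK subrK.
have [n0|n0] := eqVneq (dot w w) 0.
  by rewrite /c n0 invr0 mulr0 !scale0r addr0.
by rewrite -scalerDl !scalerA; congr (_ *: _); rewrite /c; field.
Qed.

Lemma reflection_swap n (x u : 'rV[R]_n) : dot x x = 1 -> dot u u = 1 ->
  x *m reflection (u - x) = u.
Proof.
move=> x1 u1; rewrite /reflection; set w := u - x.
rewrite mulmxBr mulmx1 -scalemxAr mulmxA mulmx_dot mul_scalar_mx scalerA.
have nE : dot w w = 2 - 2 * dot x u.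
  by rewrite /w !dotDl !dotDr !dotNl !dotNr (dotC u x) x1 u1; ring.
have xw : dot x w = dot x u - 1 by rewrite /w dotDr dotNr x1.
have [n0|n0] := eqVneq (dot w w) 0.
  have /eqP := n0; rewrite dot_eq0 subr_eq0 => /eqP ->.
  by rewrite n0 invr0 mulr0 mul0r scale0r subr0.
have -> : 2 / dot w w * dot x w = -1.
  by move: n0; rewrite nE xw => n0; field.
by rewrite scaleN1r opprK /w addrC subrK.
Qed.

(** The reflection that swaps the first basis vector and [u] is an orthogonal
    matrix with first row [u]; the other rows form the frame. *)
Lemma exists_frame u : dot u u = 1 ->
  exists U, U *m U^T = 1%:M /\ U *m u^T = 0.
Proof.
move=> u1; pose e : 'rV[R]_(1 + k) := delta_mx 0 0.
have ee : dot e e = 1 by rewrite dotE /e trmx_delta mul_delta_mx mxE.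
pose H : 'M[R]_(1 + k) := reflection ((u : 'rV[R]_(1 + k)) - e).
have eH : e *m H = u by exact: reflection_swap.
have HH : H *m H = 1%:M by exact: reflectionK.
have HT : H^T = H by exact: reflection_sym.
have e0 : dsubmx H *m H = dsubmx (1%:M : 'M[R]_(1 + k)) by rewrite mul_dsub_mx HH.
exists (dsubmx H); split.
  have : dsubmx H *m H^T = dsubmx (1%:M : 'M[R]_(1 + k)) by rewrite HT.
  move/(congr1 rsubmx); rewrite -{2}[H]vsubmxK tr_col_mx mul_mx_row row_mxKr => ->.
  by rewrite scalar_mx_block /block_mx col_mxKd row_mxKr.
rewrite -eH trmx_mul HT mulmxA e0 mul_dsub_mx mul1mx.
by apply/colP => i; rewrite !mxE; case: eqP => // /(congr1 val).
Qed.

(** Passing from the ambient points to their parameters is a linear substitution in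
    homogeneous coordinates. *)
Lemma homog_flat n (w : 'I_n -> 'rV[R]_d) (y : 'I_n -> 'rV[R]_k) x0 U :
  (forall j, w j = x0 + y j *m U) ->
  homog w = homog y *m (block_mx 1%:M x0 0 U : 'M[R]_(1 + k, 1 + d)).
Proof.
move=> yE; apply/row_matrixP => j; rewrite row_mul !rowK yE mul_row_block.
by rewrite !mul1mx mulmx0 addr0.
Qed.

Lemma homog_flat_unit (w : 'I_d -> 'rV[R]_d) (y : 'I_d -> 'rV[R]_k) x0 U :
  (forall j, w j = x0 + y j *m U) -> row_free (homog w) ->
  (homog y : 'M[R]_(1 + k)) \in unitmx.
Proof.
move=> yE /eqP rk; rewrite -row_full_unit /row_full eqn_leq rank_leq_col /=.
by rewrite -[X in (X <= _)%N]rk (homog_flat yE); exact: mxrankM_maxl.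
Qed.

Section Facet.
Variables (I : finType) (v : I -> 'rV[R]_d) (J : {set I}) (u : 'rV[R]_d) (b : R) (f : 'I_d -> I).
Hypothesis F : facial v J u b f.

Lemma frame_complete U : U *m U^T = 1%:M -> U *m u^T = 0 ->
  U^T *m U + u^T *m u = 1%:M.
Proof.
move=> UU Uu; have u1 : dot u u = 1 by case: F => -[].
pose O : 'M[R]_(1 + k) := col_mx u U.
have : O *m O^T = 1%:M.
  rewrite /O tr_col_mx mul_col_row UU Uu mulmx_dot u1.
  by rewrite -[u *m U^T]trmxK trmx_mul trmxK Uu trmx0 -scalar_mx_block.
by move/mulmx1C; rewrite /O tr_col_mx mul_row_col addrC.
Qed.

Lemma facial_sub_flat x : hull v J x -> dot x u = b.
Proof. by case: F => -[_ vb Jb] _ _; rewrite -(hull_tight vb Jb) => -[]. Qed.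

(** The properties of the parametrizations that occur in [flat_vol] for a facet on
    the hyperplane [dot x u = b]; the last one inverts the parametrization. *)
Definition facet_param (x0 : 'rV[R]_d) U := [/\ U *m U^T = 1%:M, U *m u^T = 0, dot x0 u = b &
   forall x, dot x u = b -> x = x0 + ((x - x0) *m U^T) *m U].

Lemma param_frame x0 U : U *m U^T = 1%:M -> U *m u^T = 0 -> dot x0 u = b -> facet_param x0 U.
Proof.
move=> UU Uu x0b; split=> // x xb.
rewrite -mulmxA (_ : U^T *m U = 1%:M - u^T *m u); last first.
  by rewrite -(frame_complete UU Uu) addrK.
rewrite mulmxBr mulmx1 mulmxA mulmx_dot dotDl dotNl xb x0b subrr mul_scalar_mx scale0r subr0.
by rewrite addrC subrK.
Qed.

(** A reflection provides one parametrization, so the value chosen in [flat_vol]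
    comes from some parametrization. As the facet spans its hyperplane, the latter
    is the range of any parametrization containing the facet, which makes [U]
    orthogonal to [u]. *)
Lemma flat_vol_param : exists x0 U, facet_param x0 U /\
  flat_vol k (hull v J) = lebesgue_rV [set y : 'rV[R]_k | hull v J (x0 + y *m U)].
Proof.
have [S fJ ff] := F; have [u1 vb Jb] := S.
have [x0 [U [UU sub ->]]] : [set r | exists (x0 : 'rV[R]_d) (U : 'M[R]_(k, d)),
    [/\ U *m U^T = 1%:M,
        hull v J `<=` range (fun y : 'rV[R]_k => x0 + y *m U)
      & r = lebesgue_rV [set y : 'rV[R]_k | hull v J (x0 + y *m U)]]] (flat_vol k (hull v J)).
  apply: getPex; have [U [UU Uu]] := exists_frame u1.
  have [|_ _ _ P] := @param_frame (b *: u) U UU Uu; first by rewrite dotZl u1 mulr1.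
  exists (lebesgue_rV [set y : 'rV[R]_k | hull v J (b *: u + y *m U)]), (b *: u), U; split=> //.
  by move=> x /facial_sub_flat xb; exists ((x - b *: u) *m U^T) => //; rewrite -P.
exists x0, U; split=> //.
have /choice[y yE] : forall j, exists y : 'rV[R]_k, v (f j) = x0 + y *m U.
  by move=> j; have [y _ <-] := sub _ (hull_vertex v (fJ j)); exists y.
have HE := homog_flat yE.
have uY := homog_flat_unit yE ff.
set B := block_mx _ _ _ _ in HE.
have : B *m slack u b = 0.
  apply: (can_inj (mulKmx uY)); rewrite mulmxA -HE mulmx0.
  exact/homog_slack0/(facial_tight F).
rewrite /B /slack mul_block_col mul1mx mul0mx add0r !mulmxN mulmx_dot => /eqP.
rewrite col_mx_eq0 oppr_eq0 => /andP[/eqP/matrixP/(_ 0 0)] + /eqP Uu.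
rewrite !mxE !mulr1n => /eqP; rewrite subr_eq0 => /eqP x0b.
exact: param_frame.
Qed.

End Facet.
End Parametrization.

(** * Volumes of facets *)

Section FlatVolume.
Context {R : realType} {k : nat}.
Local Notation d := k.+1.
Implicit Types (x u p : 'rV[R]_d) (b : R) (U : 'M[R]_(k, d)).

(** Multiplying by the transpose of the orthogonal matrix with rows [u] and [U]
    leaves a triangular matrix with the corner entry [dot q u]. *)
Lemma det_frame u U (q : 'rV[R]_d) : U *m U^T = 1%:M -> U *m u^T = 0 -> dot u u = 1 ->
  `|\det (col_mx q U : 'M[R]_(1 + k))| = `|dot q u|.
Proof.
move=> UU Uu u1; pose O : 'M[R]_(1 + k) := col_mx u U.
have E (r : 'rV[R]_d) : (col_mx r U : 'M[R]_(1 + k)) *m O^T = block_mx (dot r u)%:M (r *m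
  U^T) 0 1%:M.
  by rewrite /O tr_col_mx mul_col_row UU Uu mulmx_dot.
have dE (r : 'rV[R]_d) : \det (col_mx r U : 'M[R]_(1 + k)) * \det O = dot r u.
  by rewrite -(det_tr O) -det_mulmx E det_ublock det1 mulr1 det_scalar1.
have O1 : `|\det O| = 1.
  have := dE u; rewrite u1 -expr2 => /eqP.
  by rewrite sqrf_eq1 => /orP[] /eqP ->; rewrite ?normrN normr1.
by rewrite -dE normrM O1 mulr1.
Qed.

(** The volume of a pyramid with apex [p] is the volume of its base times its
    height, up to the common factorial. *)
Lemma det_cone u b x0 U (w : 'I_d -> 'rV[R]_d) (y : 'I_d -> 'rV[R]_k) p :
  U *m U^T = 1%:M -> U *m u^T = 0 -> dot u u = 1 -> dot x0 u = b ->
  (forall j, w j = x0 + y j *m U) ->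
  `|\det (\matrix_(j < d) (w j - p))| = `|\det (homog y : 'M[R]_(1 + k))| * `|b - dot p u|.
Proof.
move=> UU Uu u1 x0b yE.
have -> : (\matrix_(j < d) (w j - p)) = (homog y : 'M[R]_(1 + k)) *m (col_mx (x0 - p) U :
  'M[R]_(1 + k)).
  apply/row_matrixP => j; rewrite row_mul !rowK mul_row_col mul1mx yE.
  by rewrite addrAC.
rewrite (@det_mulmx _ (1 + k)) normrM (det_frame _ UU Uu u1).
by rewrite dotDl dotNl x0b.
Qed.

Section Facet.
Variables (I : finType) (v : I -> 'rV[R]_d) (J : {set I}) (u : 'rV[R]_d) (b : R) (f : 'I_d -> I).
Hypothesis F : facial v J u b f.
Variables (x0 : 'rV[R]_d) (U : 'M[R]_(k, d)).
Hypothesis par : facet_param u b x0 U.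

Let y j : 'rV[R]_k := (v (f j) - x0) *m U^T.

Lemma param_vertex j : v (f j) = x0 + y j *m U.
Proof. by case: par => _ _ _; apply; exact: (facial_tight F). Qed.

Lemma facet_det p : `|\det (\matrix_(j < d) (v (f j) - p))| =
  `|\det (homog y : 'M[R]_(1 + k))| * `|b - dot p u|.
Proof.
have [UU Uu x0b _] := par; have u1 : dot u u = 1 by case: F => -[].
exact: (det_cone p UU Uu u1 x0b param_vertex).
Qed.

Lemma facet_det_neq0 : \det (homog y : 'M[R]_(1 + k)) != 0.
Proof.
rewrite -unitfE -unitmxE; apply: (homog_flat_unit param_vertex).
by case: F.
Qed.

Lemma sub_facet_simplex : hull y [set: 'I_d]%SET `<=` [set z | hull v J (x0 + z *m U)].
Proof.
move=> z [w [w0 _ w1 ->]] /=; have [_ fJ _] := F.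
exists (fun i => \sum_(j | f j == i) w j); split.
- by move=> i; apply: sumr_ge0.
- by move=> i iJ; apply: big1 => j /eqP fj; move: iJ; rewrite -fj fJ.
- by rewrite -w1 (partition_big f predT).
- rewrite mulmx_suml -[x0]scale1r -w1 scaler_suml -big_split /=.
  rewrite (partition_big f predT)//=; apply: eq_bigr => i _.
  by rewrite scaler_suml; apply: eq_bigr => j /eqP <-; rewrite -scalemxAl -scalerDr -param_vertex.
Qed.

Lemma facet_simplex : injective f -> J = [set f j | j : 'I_d]%SET ->
  [set z | hull v J (x0 + z *m U)] = hull y [set: 'I_d]%SET.
Proof.
move=> fI JE; apply/seteqP; split; last exact: sub_facet_simplex.
move=> z [w [w0 wJ w1 xE]]; have [UU _ _ _] := par.
have sumE (V : nmodType) (g : I -> V) : (forall i, i \notin J -> g i = 0) ->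
    \sum_i g i = \sum_j g (f j).
  move=> g0; rewrite (bigID (mem J)) /= [X in _ + X]big1 ?addr0//.
  by rewrite JE big_imset//= => i j _ _; exact: fI.
have wf : \sum_j w (f j) = 1 by rewrite -w1 (sumE _ w).
exists (w \o f); split => //=; first by move=> j; rewrite inE.
have -> : z = (x0 + z *m U - x0) *m U^T by rewrite addrC addKr -mulmxA UU mulmx1.
rewrite xE (sumE _ (fun i => w i *: v i)); last by move=> i /wJ ->; rewrite scale0r.
rewrite -[x0 in LHS]scale1r -wf scaler_suml -sumrB mulmx_suml.
by apply: eq_bigr => j _; rewrite -scalerBr -scalemxAl.
Qed.

End Facet.

(** Any apex [p] off the hyperplane computes the volume of a simplicial facet from
    a determinant in the ambient coordinates. *)
Lemma flat_vol_simplex (I : finType) (v : I -> 'rV[R]_d) J u b (f : 'I_d -> I) p :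
  facial v J u b f -> injective f -> J = [set f j | j : 'I_d]%SET -> dot p u != b ->
  flat_vol k (hull v J) =
  (`|\det (\matrix_(j < d) (v (f j) - p))| / (`|b - dot p u| * k`!%:R))%:E.
Proof.
move=> F fI JE pu; have [x0 [U [par ->]]] := flat_vol_param F.
rewrite (facet_simplex F par fI JE) lebesgue_rV_simplex; last exact: (facet_det_neq0 F par).
rewrite (facet_det F par); congr (_%:E).
have h : `|b - dot p u| != 0 by rewrite normr_eq0 subr_eq0 eq_sym.
have h' : k`!%:R != 0 :> R by rewrite pnatr_eq0 -lt0n fact_gt0.
by field; apply/andP.
Qed.

Lemma det_int n (M : 'M[R]_n) : (forall i j, M i j \is a Num.int) -> \det M \is a Num.int.
Proof.
move=> Mint; apply: rpred_sum => s _; rewrite rpredM ?rpred_prod//.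
by rewrite rpredX// rpredN rpred1.
Qed.

Lemma norm_int (x : R) : (`|x| \is a Num.int) = (x \is a Num.int).
Proof. by case: ger0P => _ //; rewrite rpredN. Qed.

(** The apex [v (f 0) + e_i] has height [|u_i|] over the hyperplane, and the
    corresponding determinant is an integer. *)
Lemma flat_vol_int (I : finType) (v : I -> 'rV[R]_d) J u b (f : 'I_d -> I) x0 U :
  (forall i j, v i 0 j \is a Num.int) -> facial v J u b f -> facet_param u b x0 U ->
  vmeas [set y : 'rV[R]_k | hull v J (x0 + y *m U)] ->
  exists D, [/\ 0 < D, forall i, D * u 0 i \is a Num.int &
    ((D / k`!%:R)%:E <= lebesgue_rV [set y : 'rV[R]_k | hull v J (x0 + y *m U)%R])%E].
Proof.
move=> vint F par mS; have D0 := facet_det_neq0 F par.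
set y := fun _ => _ in D0.
exists `|\det (homog y : 'M[R]_(1 + k))|; split; first by rewrite normr_gt0.
  move=> i; pose p := v (f ord0) + delta_mx 0 i.
  have pE : dot p u = b + u 0 i.
    rewrite dotDl (facial_tight F); congr (_ + _).
    rewrite /dot (bigD1 i)//= big1 ?addr0 ?mxE ?eqxx ?mul1r// => j /negPf ji.
    by rewrite mxE ji andbF mul0r.
  have := facet_det F par p; rewrite pE.
  have -> : b - (b + u 0 i) = - u 0 i by ring.
  rewrite normrN.
  move=> E; rewrite -norm_int normrM normr_id -E norm_int.
  by apply: det_int => j l; rewrite !mxE rpredB// ?rpredD ?vint// rpred_nat.
rewrite -lebesgue_rV_simplex//; apply: le_lebesgue_rV => //; first exact: vmeas_simplex.
exact: (sub_facet_simplex F par).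
Qed.

End FlatVolume.

(** * Facets of a full-dimensional hull *)

Section SurfaceSum.
Context {R : realType} {k : nat}.
Local Notation d := k.+1.
Variables (I : finType) (v : I -> 'rV[R]_d).
Hypothesis fullv : fulldim v.
Let P := hull v [set: I]%SET.

(** The index set of the facets; it is boolean so that finite sums over it make
    sense. *)
Definition isfacial J := `[< exists u b f, facial v J u b f >].

Lemma surface_area_hull :
  surface_area P = (\sum_(J | isfacial J) flat_vol k (hull v J))%E.
Proof.
have fl J : isfacial J -> (0 <= flat_vol k (hull v J))%E.
  case/asboolP => u [b [f F]]; have [x0 [U [_ ->]]] := flat_vol_param F.
  exact: lebesgue_rV_ge0.
have bij : set_bij [set J | isfacial J] (facets P) (hull v).
  split.
  - move=> J /asboolP[u [b [f F]]].
    split; last exact: (has_dim_facial (ltn0Sn k) F).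
    have [[_ vb Jb] _ _] := F; exists u, b; split; last by rewrite -(hull_tight vb Jb).
    by move=> x; exact: hull_le.
  - move=> J K; rewrite !inE => /asboolP[u [b [f [S _ _]]]] /asboolP[u' [b' [f' [S' _ _]]]] JK.
    apply/eqP; rewrite finset.eqEsubset.
    by rewrite (supports_hull_inj S')// (supports_hull_inj S).
  - move=> F /(facet_facial fullv (ltn0Sn k))[J [u [b [f [F' ->]]]]]; exists J => //.
    by apply/asboolP; exists u, b, f.
rewrite /surface_area (reindex_esum _ _ _ _ bij).
rewrite esum_fset; last 2 first.
- exact: finite_finset.
- by move=> J; rewrite inE; exact: fl.
have -> : [set J | isfacial J] = [set` [seq J <- enum {set I} | isfacial J]].
  by apply/seteqP; split=> J /=; rewrite mem_filter mem_enum ?andbT// => /andP[].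
rewrite -fsbig_seq; last by rewrite filter_uniq// enum_uniq.
by rewrite big_filter big_enum_cond.
Qed.

Variables (u_ : {set I} -> 'rV[R]_d) (b_ : {set I} -> R) (f_ : {set I} -> 'I_d -> I).
Hypothesis fac : forall J, isfacial J -> facial v J (u_ J) (b_ J) (f_ J).

Lemma hrep : P = [set x | forall J, isfacial J -> dot x (u_ J) <= b_ J].
Proof.
apply/seteqP; split=> x /=.
  by move=> xP J /fac[[_ vb _] _ _]; exact: (hull_le vb xP).
move=> h; apply: contrapT => /(separating_facial fullv (ltn0Sn k))[J [u [b [f [F bx]]]]].
have JF : isfacial J by apply/asboolP; exists u, b, f.
have [S _ _] := F; have [e1 e2] := facial_unique fullv (fac JF) S.
by have := h J JF; rewrite -e1 -e2 leNgt bx.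
Qed.

Lemma vmeas_hull : vmeas P.
Proof. by rewrite hrep; apply: vmeas_bigcap => J _; exact: vmeas_halfspace. Qed.

Lemma vmeas_facet J (x0 : 'rV[R]_d) (U : 'M[R]_(k, d)) : isfacial J -> facet_param (u_ J)
  (b_ J) x0 U ->
  vmeas [set y : 'rV[R]_k | hull v J (x0 + y *m U)].
Proof.
move=> /fac[[_ vb Jb] _ _] [_ Uu xb _].
have -> : [set y : 'rV[R]_k | hull v J (x0 + y *m U)] = [set y : 'rV[R]_k | P (y *m U + x0)].
  apply/seteqP; split=> y; rewrite /= -(hull_tight vb Jb) addrC; first by case.
  move=> yP; split=> //=; rewrite dotDl xb.
  by rewrite [dot (y *m U) _]dotE -mulmxA Uu mulmx0 mxE ?add0r ?addr0.
apply: vmeas_affine; exact: vmeas_hull.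
Qed.

Lemma hull_unbounded x e : e != 0 -> ~ (forall s, 0 <= s -> P (x + s *: e)).
Proof.
move=> e0 h.
have ee : 0 < dot e e by rewrite lt_neqAle eq_sym dot_eq0 e0 dot_ge0.
pose M := \sum_i `|dot (v i) e|.
have bd y : P y -> dot y e <= M.
  apply: hull_le => i; rewrite /M (bigD1 i)//= ler_wpDr ?ler_norm//.
  by apply: sumr_ge0.
pose s := (`|M| + `|dot x e| + 1) / dot e e.
have s0 : 0 <= s by rewrite divr_ge0 ?addr_ge0 // ltW.
have := bd _ (h s s0); rewrite dotDl dotZl /s divfK ?gt_eqF//.
have := ler_norm M; have := ler_norm (- dot x e); rewrite normrN => ? ?; lra.
Qed.

Lemma hull_neq0 : exists x, P x.
Proof.
have [i|I0] := pickP (mem I); first by exists (v i); apply: hull_vertex; rewrite inE.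
have /eqP : const_mx 1 = 0 :> 'rV[R]_d by apply: (@fullv _ 0) => i; have := I0 i.
by move=> /eqP/rowP/(_ 0)/eqP; rewrite !mxE oner_eq0.
Qed.

(** Otherwise the polytope would contain the ray from any of its points in the
    direction [e]. *)
Lemma exists_facet_pos e : e != 0 -> exists2 J, isfacial J & 0 < dot e (u_ J).
Proof.
move=> e0; apply: contrapT => h; have [x xP] := hull_neq0.
apply: (hull_unbounded (x := x) e0) => s s0; rewrite hrep => J JF.
rewrite dotDl dotZl; have : dot e (u_ J) <= 0.
  by rewrite leNgt; apply/negP => eu; apply: h; exists J.
have : dot x (u_ J) <= b_ J by move: xP; rewrite hrep => /(_ J JF).
by move=> h1 h2; have := mulr_ge0_le0 s0 h2; lra.
Qed.

(** Move from [x] in the direction [e] until the first facet inequality becomes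
    tight. *)
Lemma top_facet x e : P x -> e != 0 ->
  exists J s, [/\ isfacial J, 0 < dot e (u_ J) & hull v J (x + s *: e)].
Proof.
move=> xP e0; have [J0 J0F J0e] := exists_facet_pos e0.
pose q J := (b_ J - dot x (u_ J)) / dot e (u_ J).
have pJ0 : isfacial J0 && (0 < dot e (u_ J0)) by rewrite J0F.
case: (arg_minP (P := fun J => isfacial J && (0 < dot e (u_ J))) q pJ0) => J /andP[JF Je] Jmin.
have xu K : isfacial K -> dot x (u_ K) <= b_ K by move: xP; rewrite hrep => h /h.
have s0 : 0 <= q J by rewrite divr_ge0 ?subr_ge0 ?xu// ltW.
exists J, (q J); split=> //.
have [[_ vb Jb] _ _] := fac JF; rewrite -(hull_tight vb Jb); split.
  rewrite -/P hrep => K KF; rewrite dotDl dotZl.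
  have [Ke|Ke] := ltP 0 (dot e (u_ K)).
    have := Jmin K; rewrite KF Ke => /(_ isT); rewrite {2}/q ler_pdivlMr// => ?; lra.
  by have := xu K KF; have := mulr_ge0_le0 s0 Ke; lra.
by rewrite /= dotDl dotZl /q divfK ?gt_eqF// addrC subrK.
Qed.

(** At most [d] normals would leave a direction [e <> 0] with a nonpositive product
    with each of them: if the normals are independent, solve for all products
    equal to -1, and otherwise take a vector orthogonal to all of them. This
    contradicts [exists_facet_pos]. *)
Lemma card_facets : (d < #|[set J | isfacial J]%SET|)%N.
Proof.
rewrite ltnNge; apply/negP => nd.
set G := [set J | isfacial J]%SET in nd.
pose W := \matrix_(j < #|G|) u_ (enum_val j).
suff [e e0 We] : exists2 e, e != 0 & forall J, isfacial J -> dot e (u_ J) <= 0.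
  by have [J JF] := exists_facet_pos e0; rewrite ltNge We.
have WE e : (forall j, (W *m e) j 0 <= 0) -> forall J, isfacial J -> dot e^T (u_ J) <= 0.
  move=> h J JF; have JG : J \in G by rewrite inE.
  have := h (enum_rank_in JG J); rewrite -[X in X <= _](_ : dot e^T (u_ J) = _)//.
  rewrite dotC dotE trmxK -{1}[J](enum_rankK_in JG JG).
  by rewrite -[u_ _](rowK (fun j => u_ (enum_val j))) -row_mul mxE.
have [fW|nfW] := boolP (row_free W).
  have [Q WQ] := row_freeP fW.
  pose e : 'cV[R]_d := Q *m const_mx (-1).
  have We : W *m e = const_mx (-1) by rewrite mulmxA WQ mul1mx.
  exists e^T; last by apply: WE => j; rewrite We mxE; lra.
  rewrite trmx_eq0; apply/eqP => e0.
  have [J JF _] : exists2 J, isfacial J & 0 < dot (const_mx 1) (u_ J).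
    by apply: exists_facet_pos; apply/eqP => /rowP/(_ 0)/eqP; rewrite !mxE oner_eq0.
  have JG : J \in G by rewrite inE.
  have := congr1 (fun M : 'cV[R]_#|G| => M (enum_rank_in JG J) 0) We.
  rewrite e0 mulmx0 !mxE; lra.
have rW : (\rank W < d)%N.
  apply: leq_trans nd; rewrite ltn_neqAle rank_leq_row andbT.
  exact: nfW.
have [e e0 We] := exists_kernel rW; exists e^T; first by rewrite trmx_eq0.
by apply: WE => j; rewrite We mxE.
Qed.

End SurfaceSum.

(** * The bound for arbitrary lattice polytopes *)

Section NormBounds.
Context {R : realType}.

(** The variance of the [|x_i|] is nonnegative. *)
Lemma l1_sqr_le d (x : 'rV[R]_d) : (\sum_i `|x 0 i|) ^+ 2 <= d%:R * dot x x.
Proof.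
case: d x => [|d] x; first by rewrite big_ord0 expr0n mul0r.
set s := \sum_i _; pose m := s / d.+1%:R.
have d0 : 0 < d.+1%:R :> R by rewrite ltr0n.
have : 0 <= \sum_i (`|x 0 i| - m) ^+ 2 by apply: sumr_ge0 => i _; exact: sqr_ge0.
under eq_bigr do rewrite sqrrB real_normK ?num_real//.
rewrite big_split /= sumrB sumr_const card_ord sumrMnl -mulr_suml -/s.
have -> : \sum_i x 0 i ^+ 2 = dot x x by apply: eq_bigr => i _; rewrite expr2.
move=> h; have : 0 <= d.+1%:R * (dot x x - s * m *+ 2 + m ^+ 2 *+ d.+1).
  by rewrite mulr_ge0// ltW.
suff -> : d.+1%:R * (dot x x - s * m *+ 2 + m ^+ 2 *+ d.+1) = d.+1%:R * dot x x - s ^+ 2.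
  by rewrite subr_ge0.
by rewrite /m -mulr_natr; field; rewrite ?natr1 ?nat1r pnatr_eq0.
Qed.

(** Let [r = sqrt d], [t = |x|_2] and [s = |x|_1]. Integrality gives
    [1 <= s <= t^2] and Cauchy's inequality gives [s <= r t]. The claim reads
    [r + s <= t (r + 1)]: for [t <= r] it follows from [s <= t^2] and
    [(t - 1) (r - t) >= 0], for [t >= r] from [s <= r t]. *)
Lemma int_norm_bound d (x : 'rV[R]_d) : (forall i, x 0 i \is a Num.int) -> x != 0 ->
  Num.sqrt d%:R + \sum_i `|x 0 i| <= Num.sqrt (dot x x) * (Num.sqrt d%:R + 1).
Proof.
move=> xint x0; set s := \sum_i _; set r := Num.sqrt d%:R; set t := Num.sqrt _.
have r0 : 0 <= r by exact: sqrtr_ge0.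
have t0 : 0 <= t by exact: sqrtr_ge0.
have tt : t ^+ 2 = dot x x by rewrite sqr_sqrtr// dot_ge0.
have rr : r ^+ 2 = d%:R by rewrite sqr_sqrtr// ler0n.
have s0 : 0 <= s by exact: sumr_ge0.
have srt : s <= r * t.
  rewrite -(ler_pXn2r (ltn0Sn 1)) ?nnegrE ?mulr_ge0//.
  by rewrite exprMn rr tt; exact: l1_sqr_le.
have le1 i : `|x 0 i| <= x 0 i * x 0 i.
  have [->|xi] := eqVneq (x 0 i) 0; first by rewrite normr0 mulr0.
  have h := norm_intr_ge1 (xint i) xi.
  have -> : x 0 i * x 0 i = `|x 0 i| * `|x 0 i|.
    by rewrite -normrM ger0_norm// -expr2 sqr_ge0.
  by rewrite -[X in X <= _]mulr1 ler_wpM2l.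
have st : s <= t ^+ 2 by rewrite tt; apply: ler_sum => i _.
have s1 : 1 <= s.
  have [i xi] : exists i, x 0 i != 0.
    by apply/existsP; apply: contraNT x0; rewrite negb_exists => /forallP h;
      apply/eqP/rowP => i; rewrite mxE; apply/eqP; have := h i; rewrite negbK.
  rewrite /s (bigD1 i)//=; have := norm_intr_ge1 (xint i) xi.
  have : 0 <= \sum_(j < d | j != i) `|x 0 j| by exact: sumr_ge0.
  lra.
have t1 : 1 <= t.
  by rewrite -(ler_pXn2r (ltn0Sn 1)) ?nnegrE// expr1n (le_trans s1).
have [tr|tr] := leP t r; last by lra.
have : 0 <= (t - 1) * (r - t) by rewrite mulr_ge0// subr_ge0.
by rewrite expr2 in st; lra.
Qed.

End NormBounds.

Section GeneralBound.
Context {R : realType} {k : nat}.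
Local Notation d := k.+1.
Variables (I : finType) (v : I -> 'rV[R]_d).
Hypothesis fullv : fulldim v.


Lemma facial_choice : exists t : {set I} -> 'rV[R]_d * R * ('I_d -> I),
  forall J, isfacial v J -> facial v J (t J).1.1 (t J).1.2 (t J).2.
Proof.
have [i _|I0] := pickP (mem I); last first.
  by have [x [w [_ _ +  _]]] := hull_neq0 fullv; rewrite big_pred0 // => /eqP;
    rewrite eq_sym oner_eq0.
suff /choice[t tP] : forall J, exists t : 'rV[R]_d * R * ('I_d -> I),
    isfacial v J -> facial v J t.1.1 t.1.2 t.2 by exists t.
move=> J.
have [/asboolP[u [b [f F]]]|nJ] := boolP (isfacial v J); first by exists (u, b, f).
by exists (0, 0, fun=> i).
Qed.

(** The integer vectors [A_J = D_J u_J] satisfy [int_norm_bound]; there are at least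
    [d + 1] of them, and in each coordinate the [|A_J|] add up to at least 2. *)
Theorem surface_area_ge_simplex : (forall i j, v i 0 j \is a Num.int) ->
  (((d%:R + Num.sqrt d%:R) / k`!%:R)%:E <= surface_area (hull v [set: I]%SET))%E.
Proof.
move=> vint; have [t fac] := facial_choice.
pose u_ J := (t J).1.1; pose b_ J := (t J).1.2; pose f_ J := (t J).2.
have {}fac : forall J, isfacial v J -> facial v J (u_ J) (b_ J) (f_ J) by [].
have [D DP] : exists D : {set I} -> R, forall J, isfacial v J ->
    [/\ 0 < D J, forall i, D J * u_ J 0 i \is a Num.int &
      ((D J / k`!%:R)%:E <= flat_vol k (hull v J))%E].
  suff /choice[D DP] : forall J, exists D, isfacial v J ->
      [/\ 0 < D, forall i, D * u_ J 0 i \is a Num.int &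
        ((D / k`!%:R)%:E <= flat_vol k (hull v J))%E] by exists D.
  move=> J.
  have [JF|nJ] := boolP (isfacial v J); last by exists 0.
  have [x0 [U [par ->]]] := flat_vol_param (fac _ JF).
  have [D DP] := flat_vol_int vint (fac _ JF) par (vmeas_facet fullv fac JF par).
  by exists D.
rewrite surface_area_hull//.
apply: (@le_trans _ _ (\sum_(J | isfacial v J) (D J / k`!%:R)%:E)%E); last first.
  by apply: lee_sum => J /DP[].
rewrite sumEFin lee_fin -mulr_suml ler_wpM2r ?invr_ge0//.
set r := Num.sqrt _; have r0 : 0 <= r by exact: sqrtr_ge0.
have rr : r * r = d%:R by rewrite -expr2 sqr_sqrtr.
have r1 : 0 < r + 1 by rewrite ltr_wpDl.
rewrite -(ler_pM2r r1) mulr_suml.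
have step J : isfacial v J -> r + \sum_i `|D J * u_ J 0 i| <= D J * (r + 1).
  move=> JF; have [D0 Dint _] := DP J JF; have [[u1 _ _] _ _] := fac J JF.
  have := @int_norm_bound R d (D J *: u_ J).
  rewrite dotZl dotZr u1 mulr1 -expr2 sqrtr_sqr gtr0_norm// -/r.
  under eq_bigr do rewrite mxE; apply.
    by move=> i; rewrite mxE.
  rewrite scaler_eq0 (gt_eqF D0) /= -dot_eq0 u1 oner_eq0 //.
apply: le_trans (ler_sum (P := isfacial v) _ step).
rewrite big_split /= sumr_const exchange_big /=.
have S2 i : 2 <= \sum_(J | isfacial v J) `|D J * u_ J 0 i|.
  have e0 : delta_mx 0 i != 0 :> 'rV[R]_d.
    by apply/eqP => /rowP/(_ i)/eqP; rewrite !mxE !eqxx oner_eq0.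
  have eu (w : 'rV[R]_d) : dot (delta_mx 0 i) w = w 0 i.
    rewrite /dot (bigD1 i)//= big1 ?addr0 ?mxE ?eqxx ?mul1r// => j /negPf ji.
    by rewrite mxE ji andbF mul0r.
  have [J JF] := exists_facet_pos fullv fac e0; rewrite eu => Ju.
  have [|K KF] := @exists_facet_pos _ _ _ v fullv _ _ _ fac (- delta_mx 0 i);
    first by rewrite oppr_eq0.
  rewrite dotNl eu oppr_gt0 => Ku.
  have JK : K != J by apply: contraTneq Ku => ->; rewrite -leNgt ltW.
  have ge1 L : isfacial v L -> u_ L 0 i != 0 -> 1 <= `|D L * u_ L 0 i|.
    move=> LF Lu; have [D0 Dint _] := DP L LF; apply: norm_intr_ge1 => //.
    by rewrite mulf_neq0// gt_eqF.
  rewrite (bigD1 J)//= (bigD1 K) /=; last by rewrite KF.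
  have := ge1 J JF (lt0r_neq0 Ju); have := ge1 K KF (ltr0_neq0 Ku).
  have : 0 <= \sum_(L | isfacial v L && (L != J) && (L != K)) `|D L * u_ L 0 i| by exact: sumr_ge0.
  lra.
have : \sum_(i < d) 2 <= \sum_(i < d) \sum_(J | isfacial v J) `|D J * u_ J 0 i| :> R.
  by apply: ler_sum => i _.
rewrite sumr_const card_ord -[2 *+ d]mulr_natr.
have cG : d%:R + 1 <= #|[pred J | isfacial v J]|%:R :> R.
  rewrite natr1 ler_nat; have := card_facets fullv fac.
  by rewrite (eq_card (B := [pred J | isfacial v J])) // => J; rewrite !inE.
have h1 : r * (d%:R + 1) <= r *+ #|[pred J | isfacial v J]|.
  by rewrite -[X in _ <= X]mulr_natr ler_wpM2l.
move=> h2; apply: le_trans (lerD h1 h2); rewrite -rr; lra.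
Qed.

End GeneralBound.

(** * The bound for symmetric lattice polytopes *)

Section SymmetricBound.
Context {R : realType} {k : nat}.
Local Notation d := k.+1.

Lemma dot_delta (i : 'I_d) (w : 'rV[R]_d) : dot (delta_mx 0 i) w = w 0 i.
Proof.
rewrite /dot (bigD1 i)//= big1 ?addr0 ?mxE ?eqxx ?mul1r// => j /negPf ji.
by rewrite mxE ji andbF mul0r.
Qed.

Lemma col'_mulmx m n p (i : 'I_p) (A : 'M[R]_(m, n)) (B : 'M[R]_(n, p)) :
  col' i (A *m B) = A *m col' i B.
Proof. by apply/matrixP => a c; rewrite !mxE; apply: eq_bigr => e _; rewrite mxE. Qed.

Lemma det_frame_col' u (U : 'M[R]_(k, d)) i : U *m U^T = 1%:M -> U *m u^T = 0 -> dot u u = 1 ->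
  `|\det (col' i U)| = `|u 0 i|.
Proof.
move=> UU Uu u1; rewrite -dot_delta -(det_frame _ UU Uu u1).
set M : 'M[R]_(1 + k) := col_mx _ _.
have z0 : (0 : 'I_(1 + k)) = lshift k 0 by exact: val_inj.
have M0 j : M 0 j = (i == j)%:R.
  by rewrite z0 (@col_mxEu _ 1 k) mxE eqxx eq_sym.
rewrite (expand_det_row M 0) (bigD1 i)//= big1 ?addr0; last first.
  by move=> j ji; rewrite M0 eq_sym (negPf ji) mul0r.
rewrite M0 eqxx mul1r /cofactor normrM normrX normrN1 expr1n mul1r.
congr (`|\det _|); apply/matrixP => a c; rewrite [LHS]mxE [RHS]mxE [RHS]mxE.
have -> : lift 0 a = rshift 1 a by exact: val_inj.
exact/esym/(@col_mxEd _ 1 k).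
Qed.

Variables (I : finType) (v : I -> 'rV[R]_d).
Hypothesis fullv : fulldim v.
Let P := hull v [set: I]%SET.
Variables (u_ : {set I} -> 'rV[R]_d) (b_ : {set I} -> R) (f_ : {set I} -> 'I_d -> I).
Hypothesis fac : forall J, isfacial v J -> facial v J (u_ J) (b_ J) (f_ J).

(** If the projected points did not span, a linear functional not depending on the
    [i]-th coordinate would vanish on all points. *)
Lemma exists_projected_basis i : exists g : 'I_k -> I,
  (\matrix_(j < k) col' i (v (g j))) \in unitmx.
Proof.
pose T := \matrix_(j < #|I|) col' i (v (enum_val j)) : 'M[R]_(#|I|, k).
have fT : row_full T.
  rewrite -col_leq_rank leqNgt; apply/negP => /exists_kernel[c c0 Tc].
  pose u : 'rV[R]_d := \row_j (if unlift i j is Some l then c l 0 else 0).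
  have /rowP u0 : u = 0.
    apply: (@fullv u 0) => l.
    rewrite /dot (bigD1_ord i)//= mxE unlift_none mulr0 add0r.
    have := congr1 (row (enum_rank l)) Tc; rewrite row_mul rowK enum_rankK row0.
    move=> /matrixP/(_ 0 0); rewrite !mxE => E; rewrite -[RHS]E.
    by apply: eq_bigr => j _; rewrite !mxE liftK.
  move/eqP: c0; apply; apply/colP => l; have := u0 (lift i l).
  by rewrite !mxE liftK.
exists (fun j => enum_val (fullrankfun fT j)).
have := fullrowsub_unit fT; congr (_ \in unitmx).
by apply/row_matrixP => j; rewrite row_rowsub !rowK.
Qed.

(** By symmetry every facet inequality [dot x u <= b] also bounds [|dot x u|]. *)
Lemma symmetric_comb n (g : 'I_n -> I) (s : 'I_n -> R) :
  (forall x, P x -> P (- x)) -> \sum_j `|s j| <= 1 -> P (\sum_j s j *: v (g j)).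
Proof.
move=> PN s1; rewrite /P (hrep fullv fac) => J JF.
have uP x : P x -> `|dot x (u_ J)| <= b_ J.
  move=> xP; rewrite ler_norml lerNl -dotNl.
  by have := xP; have := PN x xP; rewrite /P (hrep fullv fac) => /(_ J JF) -> /(_ J JF) ->.
have b0 : 0 <= b_ J.
  by have [x xP] := hull_neq0 fullv; apply: le_trans (uP x xP).
rewrite dot_suml; apply: le_trans (ler_norm _) _; apply: le_trans (ler_norm_sum _ _ _) _.
rewrite -[b_ J]mul1r; apply: le_trans (ler_wpM2r b0 s1); rewrite mulr_suml.
apply: ler_sum => j _; rewrite dotZl normrM ler_wpM2l// uP//.
by apply: hull_vertex; rewrite inE.
Qed.

(** Deleting the [i]-th coordinate acts on the parameters of the facet by the
    affine map with linear part [col' i U], whose determinant is [u_i] up to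
    sign. *)
Lemma projected_facet J x0 (U : 'M[R]_(k, d)) i : isfacial v J -> facet_param (u_ J) (b_ J) x0 U ->
  u_ J 0 i != 0 -> exists A : set 'rV[R]_k,
  [/\ vmeas A, lebesgue_rV A = (`|u_ J 0 i|%:E * lebesgue_rV [set y : 'rV[R]_k | hull v J
    (x0 + y *m U)%R])%E
    & forall x, hull v J x -> A (col' i x)].
Proof.
move=> JF par ui; have [UU Uu x0b xE] := par; have [[u1 vb Jb] _ _] := fac JF.
have mS := vmeas_facet fullv fac JF par.
set S := [set y | _] in mS *.
have dV := det_frame_col' i UU Uu u1; set V := col' i U in dV.
have uV : V \in unitmx by rewrite unitmxE unitfE -normr_eq0 dV normr_eq0.
exists [set z | S (z *m invmx V + - (col' i x0 *m invmx V))]; split.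
- exact: vmeas_affine.
- by rewrite lebesgue_rV_affine ?unitmx_inv// det_inv normrV// invrK dV.
move=> x xJ /=; rewrite -mulmxBl.
have xb : dot x (u_ J) = b_ J by exact: (facial_sub_flat (fac JF)).
have e := xE x xb; set y := (x - x0) *m U^T in e.
have -> : col' i x - col' i x0 = y *m V.
  by rewrite -col'_mulmx -linearB /= {1}e addrC addKr.
by rewrite mulmxK// /S /= -e.
Qed.

Hypothesis vint : forall i j, v i 0 j \is a Num.int.
Hypothesis PN : forall x, P x -> P (- x).

(** A point of the projected cross-polytope [C] lifts to a point of [P], from which
    the direction [e * e_i] leads to a facet with the required sign; moving in
    that direction does not change the projection. *)
Lemma projection_bound (i : 'I_d) (e : R) : e != 0 ->
  ((2 ^+ k / k`!%:R)%:E <=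
   \sum_(J | isfacial v J && (0 < e * u_ J 0 i)%R) `|u_ J 0 i|%:E * flat_vol k (hull v J))%E.
Proof.
move=> e0.
have [g] := exists_projected_basis i; set W := \matrix_j _ => uW.
have W1 : 1 <= `|\det W|.
  apply: norm_intr_ge1; last by rewrite -unitfE -unitmxE.
  by apply: det_int => a c; rewrite !mxE.
pose C := [set z : 'rV[R]_k | l1ball 1 (z *m invmx W + 0)].
have mC : vmeas C by apply: vmeas_affine; exact: vmeas_l1ball.
have CE : lebesgue_rV C = (`|\det W| * (2 ^+ k / k`!%:R))%:E.
  rewrite /C lebesgue_rV_affine ?unitmx_inv//; last exact: vmeas_l1ball.
  by rewrite lebesgue_rV_l1ball// mulr1 det_inv normrV// invrK.
apply: (@le_trans _ _ (lebesgue_rV C)).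
  by rewrite CE lee_fin ler_peMl// divr_ge0// exprn_ge0.
have /choice[A AP] : forall J, exists A : set 'rV[R]_k, isfacial v J && (0 < e * u_ J 0 i) ->
    [/\ vmeas A, lebesgue_rV A = (`|u_ J 0 i|%:E * flat_vol k (hull v J))%E
      & forall x, hull v J x -> A (col' i x)].
  move=> J; have [/andP[JF Ju]|_] := boolP (isfacial v J && (0 < e * u_ J 0 i));
    last by exists set0.
  have [x0 [U [par ->]]] := flat_vol_param (fac JF).
  have [|A AP] := projected_facet JF par (i := i); last by exists A.
  by apply: contraTneq Ju => ->; rewrite mulr0 ltxx.
apply: le_trans (lebesgue_rV_subadditive (P := fun J => isfacial v J && (0 < e * u_ J 0
  i)) (F := A) mC _ _) _.
- by move=> J /AP[].
- move=> z; rewrite /C /l1ball /= addr0.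
  have : (z *m invmx W) *m W = z by rewrite mulmxKV.
  move: (z *m invmx W) => s sW zs.
  have xP := symmetric_comb g PN zs.
  have xz : col' i (\sum_j s 0 j *: v (g j)) = z.
    rewrite linear_sum /= -[RHS]sW mulmx_sum_row.
    by apply: eq_bigr => j _; rewrite linearZ /= rowK.
  have [|J [t [JF Ju xJ]]] := top_facet fullv fac (e := e *: delta_mx 0 i) xP.
    by rewrite scaler_eq0 (negPf e0) /=; apply/eqP => /rowP/(_ i)/eqP; rewrite !mxE !eqxx oner_eq0.
  rewrite dotZl dot_delta in Ju.
  have JP : isfacial v J && (0 < e * u_ J 0 i) by rewrite JF.
  exists J => //; have [_ _ /(_ _ xJ)] := AP J JP.
  rewrite linearD /= xz; congr (A J _).
  rewrite !linearZ /= (_ : col' i (delta_mx 0 i) = 0) ?scaler0 ?addr0//.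
  by apply/rowP => j; rewrite !mxE eq_sym (negPf (neq_lift _ _)) andbF.
- by apply: lee_sum => J /AP[_ -> _].
Qed.

(** The facets with positive and those with negative [i]-th normal coordinate each
    cover the projection along [e_i], so together they contribute twice the bound
    of [projection_bound]; then add over [i]. *)
Theorem surface_area_ge_cross_polytope :
  ((2 ^+ d * Num.sqrt d%:R / k`!%:R)%:E <= surface_area P)%E.
Proof.
rewrite surface_area_hull//.
set vol := fun J => flat_vol k (hull v J).
have vol0 J : isfacial v J -> (0 <= vol J)%E.
  by move=> JF; rewrite /vol; have [x0 [U [_ ->]]] := flat_vol_param (fac JF);
    exact: lebesgue_rV_ge0.
have coord i : ((2 * (2 ^+ k / k`!%:R))%:E <= \sum_(J | isfacial v J) `|u_ J 0 i|%:E * vol J)%E.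
  have p1 := @projection_bound i 1 (oner_neq0 _).
  have n1 : -1 != 0 :> R by rewrite oppr_eq0 oner_eq0.
  have p2 := projection_bound i n1.
  rewrite mulr2n mulrDl mul1r EFinD; apply: le_trans (leeD p1 p2) _.
  rewrite (bigID (fun J => 0 < u_ J 0 i) (isfacial v)) /=.
  under [X in (X + _ <= _)%E]eq_bigl do rewrite mul1r.
  apply: leeD => //.
  rewrite [X in (X <= _)%E]big_mkcond [X in (_ <= X)%E]big_mkcond /=.
  apply: lee_sum => J _; case: (boolP (isfacial v J)) => //= JF.
  rewrite mulN1r oppr_gt0 -leNgt; case: ltP => [/ltW -> //|u0].
  by case: ifP => // _; apply: mule_ge0; [rewrite lee_fin|exact: vol0].
have r0 : 0 < Num.sqrt d%:R :> R by rewrite sqrtr_gt0 ltr0n.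
have l1 J : isfacial v J -> \sum_i `|u_ J 0 i| <= Num.sqrt d%:R.
  move=> /fac[[u1 _ _] _ _].
  rewrite -(ler_pXn2r (ltn0Sn 1)) ?nnegrE ?sumr_ge0 ?(ltW r0)// sqr_sqrtr ?ler0n//.
  by have := l1_sqr_le (u_ J); rewrite u1 mulr1.
have : (\sum_(i < d) (2 * (2 ^+ k / k`!%:R))%:E <= (Num.sqrt d%:R)%:E * \sum_(J |
  isfacial v J) vol J)%E.
  apply: le_trans (lee_sum _ (fun i _ => coord i)) _.
  rewrite exchange_big /= ge0_sume_distrr//; apply: lee_sum => J JF.
  rewrite -ge0_sume_distrl; last by move=> i _; rewrite lee_fin.
  by rewrite lee_wpmul2r ?vol0// sumEFin lee_fin l1.
rewrite sumEFin sumr_const card_ord => h.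
have r2 : Num.sqrt d%:R * Num.sqrt d%:R = d%:R :> R by rewrite -expr2 sqr_sqrtr ?ler0n.
have ri : (0 <= ((Num.sqrt d%:R)^-1)%:E :> \bar R)%E by rewrite lee_fin invr_ge0 ltW.
have := lee_wpmul2l ri h.
rewrite [X in (_ <= X)%E]muleA -[X in (_ <= X * _)%E]EFinM mulVf ?gt_eqF// mul1e.
apply: le_trans.
rewrite -EFinM lee_fin le_eqVlt; apply/orP; left; apply/eqP.
rewrite exprS -(mulr_natr (2 * (2 ^+ k / k`!%:R))) -[X in _ = _ * (_ * X)]r2.
have f0 : k`!%:R != 0 :> R by rewrite pnatr_eq0 -lt0n fact_gt0.
move: (lt0r_neq0 r0); set r := Num.sqrt _ => s0.
by field; apply/andP.
Qed.

End SymmetricBound.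

(** * The surface areas of the cross-polytope and the standard simplex *)

Section Examples.
Context {R : realType} {k : nat}.
Local Notation d := k.+1.

(** Edge vectors from an apex that are linearly independent certify affine
    independence of the base points. *)
Lemma row_free_apex (w : 'I_d -> 'rV[R]_d) p :
  \det (\matrix_(j < d) (w j - p)) != 0 -> row_free (homog w).
Proof.
rewrite -unitfE -unitmxE -row_full_unit => /eqP rk.
have E : \matrix_(j < d) (w j - p) = homog w *m col_mx (- p) 1%:M.
  by apply/row_matrixP => j; rewrite row_mul !rowK mul_row_col mul1mx mulmx1 addrC.
rewrite /row_free eqn_leq rank_leq_row /=.
by rewrite -[X in (X <= _)%N]rk E; exact: mxrankM_maxl.
Qed.

Lemma row_free_homog_inj (I : finType) (v : I -> 'rV[R]_d) (f : 'I_d -> I) :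
  row_free (homog (v \o f)) -> injective f.
Proof.
move=> ff j l jl; apply/eqP; apply: contraT => njl.
have : delta_mx 0 j = delta_mx 0 l :> 'rV[R]_d.
  by apply: (row_free_inj ff); rewrite -!rowE !rowK /= jl.
by move/rowP/(_ j)/eqP; rewrite !mxE !eqxx (negPf njl) oner_eq0.
Qed.

Lemma facial_apex (I : finType) (v : I -> 'rV[R]_d) (f : 'I_d -> I) J u b p :
  supports v J u b -> (forall j, f j \in J) ->
  `|\det (\matrix_(j < d) (v (f j) - p))| = 1 -> facial v J u b f.
Proof.
move=> S fJ D1; split=> //; apply: (@row_free_apex (v \o f) p).
by rewrite -normr_eq0 D1 oner_eq0.
Qed.

Lemma sqrtd_gt0 : 0 < Num.sqrt d%:R :> R.
Proof. by rewrite sqrtr_gt0 ltr0n. Qed.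

Lemma sqrtd_sqr : Num.sqrt d%:R * Num.sqrt d%:R = d%:R :> R.
Proof. by rewrite -expr2 sqr_sqrtr ?ler0n. Qed.

Section Cross.

Definition cross_vertex (c : 'I_d * bool) : 'rV[R]_d := (-1) ^+ c.2 *: delta_mx 0 c.1.

Lemma cross_polytope_hull : cross_polytope R d = hull cross_vertex [set: 'I_d * bool]%SET.
Proof.
rewrite -conv_hullE; congr conv_hull; apply/seteqP; split=> x /=.
  case=> i [->|->]; first by exists (i, false); rewrite ?inE// /cross_vertex expr0 scale1r.
  by exists (i, true); rewrite ?inE// /cross_vertex expr1 scaleN1r.
case=> -[i []] _ <-; exists i; rewrite /cross_vertex /=; [right|left].
  by rewrite expr1 scaleN1r.
by rewrite expr0 scale1r.
Qed.

Lemma dot_cross_vertex c u : dot (cross_vertex c) u = (-1) ^+ c.2 * u 0 c.1.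
Proof. by rewrite dotZl dot_delta. Qed.

Lemma fulldim_cross : fulldim cross_vertex.
Proof.
move=> u b h; apply/rowP => i; rewrite mxE.
have := h (i, true); have := h (i, false); rewrite !dot_cross_vertex /= expr0 expr1; lra.
Qed.

(** The vertex set of the facet of the cross-polytope in the orthant with signs
    [e]. *)
Definition orthant (e : {ffun 'I_d -> bool}) : {set 'I_d * bool} := [set (i, e i) | i : 'I_d]%SET.

Lemma mem_orthant e i s : ((i, s) \in orthant e) = (s == e i).
Proof.
apply/imsetP/eqP => [[j _ [-> ->]]//|->].
by exists i.
Qed.

Lemma orthant_inj : injective orthant.
Proof.
move=> e e' h; apply/ffunP => i; apply/eqP.
by rewrite -mem_orthant -h mem_orthant.
Qed.

Definition orthant_normal (e : {ffun 'I_d -> bool}) : 'rV[R]_d :=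
  \row_i ((Num.sqrt d%:R)^-1 * (-1) ^+ e i).

Lemma orthant_det e : `|\det (\matrix_(j < d) (cross_vertex (j, e j) - 0))| = 1.
Proof.
have -> : \matrix_(j < d) (cross_vertex (j, e j) - 0) = diag_mx (\row_j (-1) ^+ e j).
  by apply/matrixP => i j; rewrite !mxE subr0 eqxx /= eq_sym mulr_natr.
rewrite det_diag normr_prod big1// => i _.
by rewrite mxE normrX normrN1 expr1n.
Qed.

Lemma facial_orthant e :
  facial cross_vertex (orthant e) (orthant_normal e) (Num.sqrt d%:R)^-1 (fun j => (j, e j)).
Proof.
have s0 := sqrtd_gt0; have si : 0 < (Num.sqrt d%:R)^-1 :> R by rewrite invr_gt0.
apply: (facial_apex (p := 0)); [split|by move=> j; rewrite mem_orthant|exact: orthant_det].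
- rewrite /dot; under eq_bigr do rewrite !mxE mulrACA -expr2 -signr_addb addbb expr0 mulr1.
  rewrite sumr_const card_ord -[LHS]mulr_natr -[X in _ * X = _]sqrtd_sqr.
  by field; exact: lt0r_neq0.
- move=> [i s]; rewrite dot_cross_vertex mxE /= mulrCA -signr_addb ger_pMr//.
  by case: (_ (+) _); rewrite ?expr0 ?expr1; lra.
- move=> [i s]; rewrite mem_orthant dot_cross_vertex mxE /= mulrCA -signr_addb.
  rewrite -[X in _ = (_ == X)]mulr1 (inj_eq (mulfI (lt0r_neq0 si))).
  by case: s; case: (e i); rewrite /= ?expr0 ?expr1 ?eqxx//; apply/esym/negbTE;
    rewrite lt_eqF//; lra.
Qed.

(** Both vertices [e_i] and [- e_i] cannot lie on a facet as [b > 0]. One of them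
    does: otherwise the [i]-th coordinate would vanish on the facet, and the
    hyperplane [x_i = 0] through the origin would be its span. *)
Lemma isfacial_cross J : isfacial cross_vertex J = (J \in [set orthant e | e : {ffun 'I_d
  -> bool}]%SET).
Proof.
apply/idP/imsetP => [/asboolP[u [b [f F]]]|[e _ ->]]; last first.
  apply/asboolP; exists (orthant_normal e), (Num.sqrt d%:R)^-1, (fun j => (j, e j)).
  exact: facial_orthant.
have [[u1 vb Jb] fJ ff] := F.
have u0 : u != 0 by rewrite -dot_eq0 u1 oner_eq0.
have ub i : `|u 0 i| <= b.
  have := vb (i, true); have := vb (i, false); rewrite !dot_cross_vertex /= expr0 expr1 ler_norml.
  by move=> h1 h2; apply/andP; split; lra.
have b0 : 0 < b.
  have [i ui] : exists i, u 0 i != 0.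
    apply/existsP; apply: contraNT u0; rewrite negb_exists => /forallP h.
    by apply/eqP/rowP => i; rewrite mxE; apply/eqP; have := h i; rewrite negbK.
  by apply: lt_le_trans (ub i); rewrite normr_gt0.
have some i : exists s, (i, s) \in J.
  apply: contrapT => nJ.
  have fi l : (f l).1 != i.
    by apply/eqP => fl; apply: nJ; exists (f l).2; rewrite -fl -surjective_pairing.
  have [|t [uE bE]] := facet_normal_unique ff (facial_tight F) u0 (u' := delta_mx 0 i) (b' := 0).
    move=> l; rewrite dot_cross_vertex mxE /= (negPf (fi l)) mulr0 //.
  have t0 : t = 0 by move/esym/eqP: bE; rewrite mulf_eq0 (gt_eqF b0) orbF => /eqP.
  by move/rowP/(_ i)/eqP: uE; rewrite t0 scale0r !mxE !eqxx oner_eq0.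
have /choice[e eJ] := some.
exists (finfun e) => //; apply/setP => -[i s]; rewrite mem_orthant ffunE.
apply/idP/eqP => [sJ|->//]; apply/eqP; apply: contraT => se.
have := eJ i; move: sJ; rewrite !Jb !dot_cross_vertex /= => /eqP h1 /eqP h2.
have : (-1) ^+ s = - (-1) ^+ e i :> R by move: se; case: s {h1}; case: (e i) {h2};
  rewrite //= expr0 expr1 ?opprK.
by move=> h; move: h1; rewrite h mulNr h2; lra.
Qed.

Lemma surface_area_cross :
  surface_area (cross_polytope R d) = (2 ^+ d * Num.sqrt d%:R / k`!%:R)%:E.
Proof.
rewrite cross_polytope_hull (surface_area_hull fulldim_cross).
rewrite (eq_bigl _ _ isfacial_cross) big_imset /=; last by move=> e e' _ _; exact: orthant_inj.
have s0 := sqrtd_gt0; have s1 := lt0r_neq0 s0.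
under eq_bigr => e _.
  have F := facial_orthant e.
  have -> : flat_vol k (hull cross_vertex (orthant e)) = (Num.sqrt d%:R / k`!%:R)%:E.
    rewrite (flat_vol_simplex (p := 0) F); last 3 first.
    - by move=> i j [].
    - by [].
    - by rewrite dot0l eq_sym invr_neq0.
    rewrite orthant_det dot0l subr0 ger0_norm ?invr_ge0 ?ltW//; congr (_%:E).
    have f0 : k`!%:R != 0 :> R by rewrite pnatr_eq0 -lt0n fact_gt0.
    by field; apply/andP.
  over.
rewrite sumEFin sumr_const card_ffun card_bool card_ord; congr (_%:E).
by rewrite -[LHS]mulr_natr natrX mulrC mulrA.
Qed.

End Cross.
Section Simplex.

Definition simplex_vertex (c : option 'I_d) : 'rV[R]_d :=
  if c is Some i then delta_mx 0 i else 0.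

Lemma std_simplex_hull : std_simplex R d = hull simplex_vertex [set: option 'I_d]%SET.
Proof.
rewrite -conv_hullE; congr conv_hull; apply/seteqP; split=> x /=.
  case=> [->|[i ->]]; first by exists None; rewrite ?inE.
  by exists (Some i); rewrite ?inE.
by case=> -[i|] _ <-; [right; exists i|left].
Qed.

Lemma dot_simplex_vertex i u : dot (simplex_vertex (Some i)) u = u 0 i.
Proof. exact: dot_delta. Qed.

Lemma fulldim_simplex : fulldim simplex_vertex.
Proof.
move=> u b h; apply/rowP => i; rewrite mxE -dot_simplex_vertex h.
by rewrite -(h None) /= dot0l.
Qed.

Definition simplex_normal (h : option 'I_d) : 'rV[R]_d :=
  if h is Some i then - delta_mx 0 i else const_mx (Num.sqrt d%:R)^-1.

Definition simplex_offset (h : option 'I_d) : R :=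
  if h is Some i then 0 else (Num.sqrt d%:R)^-1.

(** Listing the origin in the place of [h] keeps the matrix in [opposite_face_det]
    close to the identity. *)
Definition opposite_face (h : option 'I_d) (j : 'I_d) : option 'I_d :=
  if h == Some j then None else Some j.

Lemma opposite_face_inj h : injective (opposite_face h).
Proof.
move=> j l; rewrite /opposite_face.
case: eqP => [hj|_]; case: eqP => [hl|_] //; last by case.
by move: hl; rewrite hj => -[].
Qed.

Lemma opposite_faceE h : [set~ h]%SET = [set opposite_face h j | j : 'I_d]%SET.
Proof.
apply/eqP; rewrite eq_sym eqEcard; apply/andP; split.
  apply/fintype.subsetP => _ /imsetP[j _ ->]; rewrite !inE /opposite_face.
  by case: ifPn => [/eqP ->//|]; rewrite eq_sym.
rewrite card_imset; last exact: opposite_face_inj.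
by rewrite cardsC1 card_option card_ord.
Qed.

(** For [h = e_i] the matrix is an involution: the identity minus the product of a
    column [c] and the row [e_i] with [c_i = 2]. *)
Lemma opposite_face_det h :
  `|\det (\matrix_(j < d) (simplex_vertex (opposite_face h j) - simplex_vertex h))| = 1.
Proof.
case: h => [i|]; last first.
  rewrite (_ : \matrix_j _ = 1%:M) ?det1 ?normr1//.
  by apply/matrixP => a c; rewrite !mxE subr0 eqxx /= eq_sym.
set B := \matrix_j _.
pose e : 'rV[R]_d := delta_mx 0 i.
pose c : 'cV[R]_d := \col_j (if j == i then 2 else 1).
have BE : B = 1%:M - c *m e.
  apply/row_matrixP => j; rewrite rowK linearB /= row_mul row1 /opposite_face.
  have -> : row j c = (if j == i then 2 else 1)%:M.
    by apply/rowP => l; rewrite !ord1 !mxE eqxx mulr1n.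
  rewrite mul_scalar_mx eqE /= eq_sym; case: eqP => [->|_] /=.
    by rewrite sub0r scaler_nat mulr2n opprD addrA subrr sub0r.
  by rewrite scale1r.
have ec : e *m c = 2%:M.
  by rewrite [LHS]mx11_scalar -rowE !mxE eqxx.
have BB : B *m B = 1%:M.
  rewrite BE mulmxBl mul1mx mulmxBr mulmx1 -[c *m e *m _]mulmxA [e *m (_ *m _)]mulmxA ec.
  rewrite mul_scalar_mx -scalemxAr scaler_nat mulr2n.
  by rewrite opprB addrK subrK.
have := congr1 determinant BB; rewrite det_mulmx det1 -expr2 => /eqP.
by rewrite sqrf_eq1 => /orP[] /eqP ->; rewrite ?normrN normr1.
Qed.

Lemma facial_simplex h :
  facial simplex_vertex [set~ h]%SET (simplex_normal h) (simplex_offset h) (opposite_face h).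
Proof.
have s0 := sqrtd_gt0; have si : 0 < (Num.sqrt d%:R)^-1 :> R by rewrite invr_gt0.
apply: (facial_apex (p := simplex_vertex h)); last exact: opposite_face_det.
  case: h => [i|] /=; split.
  - rewrite dotNl dotNr opprK dot_delta mxE !eqxx //.
  - move=> [j|] /=; rewrite ?dot0l// dotNr dot_delta mxE oppr_le0 ler0n //.
  - move=> [j|] /=; rewrite !inE ?dot0l ?eqxx//.
    by rewrite dotNr dot_delta mxE eqxx oppr_eq0 pnatr_eq0 eqb0 /=.
  - rewrite /dot; under eq_bigr do rewrite !mxE -expr2.
    rewrite sumr_const card_ord -[LHS]mulr_natr -[X in _ * X = _]sqrtd_sqr.
    by field; exact: lt0r_neq0.
  - by move=> [j|] /=; [rewrite dot_delta mxE|rewrite dot0l ltW].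
  - move=> [j|] /=; rewrite !inE ?dot0l; last by rewrite eqxx lt_eqF.
    by rewrite dot_delta mxE eqxx.
by move=> j; rewrite opposite_faceE; apply/imsetP; exists j.
Qed.

(** A facet has at least [d] of the [d + 1] vertices, and not all of them. *)
Lemma isfacial_simplex J :
  isfacial simplex_vertex J = (J \in [set [set~ h]%SET | h : option 'I_d]%SET).
Proof.
apply/idP/imsetP => [/asboolP[u [b [f F]]]|[h _ ->]]; last first.
  apply/asboolP; exists (simplex_normal h), (simplex_offset h), (opposite_face h).
  exact: facial_simplex.
have [S fJ ff] := F; have [_ vb Jb] := S.
have fI := row_free_homog_inj ff.
have Jd : (d <= #|J|)%N.
  rewrite -[X in (X <= _)%N](card_ord d) -(card_imset predT fI); apply: subset_leq_card.
  by apply/fintype.subsetP => _ /imsetP[j _ ->].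
have [c cb] := supports_strict fulldim_simplex S.
have cJ : c \notin J by rewrite Jb lt_eqF.
exists c => //; apply/eqP; rewrite eqEcard; apply/andP; split.
  by apply/fintype.subsetP => x xJ; rewrite !inE; apply: contraNneq cJ => <-.
by rewrite cardsC1 card_option card_ord.
Qed.

Lemma surface_area_simplex :
  surface_area (std_simplex R d) = ((d%:R + Num.sqrt d%:R) / k`!%:R)%:E.
Proof.
rewrite std_simplex_hull (surface_area_hull fulldim_simplex).
rewrite (eq_bigl _ _ isfacial_simplex) big_imset /=; last first.
  move=> h h' _ _ /setP/(_ h); rewrite !inE eqxx => /esym/negbT.
  by rewrite negbK => /eqP.
have s0 := sqrtd_gt0; have s1 := lt0r_neq0 s0.
have f0 : k`!%:R != 0 :> R by rewrite pnatr_eq0 -lt0n fact_gt0.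
pose w (h : option 'I_d) := if h is Some _ then 1 else Num.sqrt d%:R : R.
have vol h : flat_vol k (hull simplex_vertex [set~ h]%SET) = (w h / k`!%:R)%:E.
  have F := facial_simplex h.
  have off : simplex_offset h - dot (simplex_vertex h) (simplex_normal h) = (w h)^-1.
    case: h {F} => [i|] /=; last by rewrite dot0l subr0.
    by rewrite dotNr dot_delta mxE !eqxx opprK add0r invr1.
  have w0 : 0 < w h by case: (h) => //=.
  rewrite (flat_vol_simplex (p := simplex_vertex h) F); last 3 first.
  - exact: opposite_face_inj.
  - exact: opposite_faceE.
  - by rewrite eq_sym -subr_eq0 off invr_neq0// lt0r_neq0.
  rewrite opposite_face_det off ger0_norm ?invr_ge0 ?ltW//; congr (_%:E).
  by field; rewrite f0 lt0r_neq0.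
under eq_bigr do rewrite vol.
rewrite sumEFin -mulr_suml; congr ((_ / _)%:E).
rewrite (bigD1 None)//= addrC; congr (_ + _).
rewrite (eq_bigr (fun=> 1)); last by case.
rewrite sumr_const; congr (_ *+ _).
rewrite (eq_card (B := predC1 (None : option 'I_d))); last by move=> h; rewrite !inE.
by rewrite cardC1 card_option card_ord.
Qed.

End Simplex.
End Examples.

Lemma powR_three_halves {R : realType} (x : R) : 0 < x -> x `^ (3 / 2) = x * Num.sqrt x.
Proof.
move=> x0; have -> : 3 / 2 = 1 + 2^-1 :> R by field.
by rewrite powRD ?powRr1 ?powR12_sqrt ?ltW// gt_eqF// implybT.
Qed.

Theorem proposition1p11 (R : realType) (d : nat) (hd : (0 < d)%N)
    (P : set 'rV[R]_d) (hP : lattice_polytope P) (hdim : has_dim P d) :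
  (P = [set - x | x in P] ->
    (surface_area P >= surface_area (cross_polytope R d))%E /\
    surface_area (cross_polytope R d) =
      (2 ^+ d / (d`!)%:R * d%:R `^ (3 / 2))%:E) /\
  (P <> [set - x | x in P] ->
    (surface_area P >= surface_area (std_simplex R d))%E /\
    surface_area (std_simplex R d) =
      ((d%:R + Num.sqrt d%:R) / ((d.-1)`!)%:R)%:E).
Proof.
case: d hd P hP hdim => // k _ P hP hdim.
have [I [v [PE vint]]] := lattice_hull hP.
have fullv : fulldim v by apply: fulldim_hull; rewrite -PE.
have [t fac] := facial_choice fullv.
split=> [Psym|_]; last first.
  by rewrite surface_area_simplex PE; split=> //; exact: surface_area_ge_simplex.
rewrite surface_area_cross; split.
  rewrite PE; apply: (surface_area_ge_cross_polytope fullv fac vint) => x.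
  by rewrite -PE => Px; rewrite Psym; exists x.
congr (_%:E); rewrite powR_three_halves ?ltr0n// factS natrM.
have f0 : k`!%:R != 0 :> R by rewrite pnatr_eq0 -lt0n fact_gt0.
by field; rewrite f0 ?natr1 ?nat1r pnatr_eq0.
Qed.
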